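(* Let $(A,\Phi)$ be a finite-dimensional $\ell$CEDS. The Koszul dual of the quadratic operad $\mathbf{PreLie}_\Phi$ is $\mathbf{Perm}_{\Phi^*}$.
   Context: $\mathbb{K}$ is a field of characteristic zero and all vector spaces are over $\mathbb{K}$; $\tau$ is the flip. An $\ell$CEDS is a pair $(A,\Phi)$ with $A$ a vector space and $\Phi:A\otimes A\to A\otimes A$ linear such that (i) $(\mathrm{Id}\otimes\Phi)\circ(\Phi\otimes\mathrm{Id})\circ(\mathrm{Id}\otimes\Phi)=(\Phi\otimes\mathrm{Id})\circ(\mathrm{Id}\otimes\tau)\circ(\Phi\otimes\mathrm{Id})$ and (ii) $(\mathrm{Id}\otimes\Phi)\circ(\mathrm{Id}\otimes\tau)\circ(\tau\otimes\mathrm{Id})\circ(\Phi\otimes\mathrm{Id})=(\tau\otimes\mathrm{Id})\circ(\Phi\otimes\mathrm{Id})\circ(\mathrm{Id}\otimes\Phi)\circ(\mathrm{Id}\otimes\tau)$. A dual $\ell$CEDS is a pair $(A,\Phi)$ satisfying (i) and (iii) $(\Phi\otimes\mathrm{Id})\circ(\tau\otimes\mathrm{Id})\circ(\mathrm{Id}\otimes\tau)\circ(\mathrm{Id}\otimes\Phi)=(\mathrm{Id}\otimes\tau)\circ(\mathrm{Id}\otimes\Phi)\circ(\Phi\otimes\mathrm{Id})\circ(\tau\otimes\mathrm{Id})$. If $(A,\Phi)$ is a finite-dimensional $\ell$CEDS, the transpose $\Phi^*:A^*\otimes A^*=(A\otimes A)^*\to(A\otimes A)^*=A^*\otimes A^*$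 makes $(A^*,\Phi^* )$ a dual $\ell$CEDS. $\mathbf{PreLie}_\Phi$ is the operad of $\Phi$-prelie algebras: with formal Sweedler notation $\Phi(a\otimes b)=\sum a'\rightarrow b'\otimes a''\triangleright b''$, these are vector spaces $V$ with products $\circ_a:V\otimes V\to V$, linear in $a\in A$, such that for all $x,y,z\in V$, $a,b\in A$: $$x\circ_a(y\circ_b z)-\sum(x\circ_{a''\triangleright b''}y)\circ_{a'\rightarrow b'}z=y\circ_b(x\circ_a z)-\sum(y\circ_{b''\triangleright a''}x)\circ_{b'\rightarrow a'}z.$$ For a dual $\ell$CEDS $(B,\Psi)$, $\mathbf{Perm}_\Psi$ is the operad of $(B,\Psi)$-permutative algebras: with formal Sweedler notation $\Psi(a\otimes b)=\sum a'\curvearrowright b'\otimes a''\blacktriangleright b''$, these are vector spaces $V$ with products $\diamond_a:V\otimes V\to V$, linear in $a\in B$, such that for all $x,y,z\in V$, $a,b\in B$: $$(x\diamond_b y)\diamond_a z=\sum x\diamond_{a'\curvearrowright b'}(y\diamond_{a''\blacktriangleright b''}z),\qquad x\diamond_a(y\diamond_b z)=y\diamond_b(x\diamond_a z).$$ The Koszul dual of a binary quadratic operad is its quadratic dual $\mathcal{P}^!$ in the usual (Ginzburg–Kapranov) sense: the quotient of the free operad on the sign-twisted dual of the generators by the ideal generated by the orthogonal of the space of relations. *)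

(* Defs.v *)
From HB Require Import structures.
From mathcomp Require Import all_boot all_order all_algebra finmap.
From mathcomp Require Import boolp.
From mathcomp Require Import monalg.

Set Implicit Arguments.
Unset Strict Implicit.
Unset Printing Implicit Defensive.

Import GRing.Theory.
Local Open Scope ring_scope.

Section Span.
Context {K : fieldType} {V : lmodType K}.

Inductive span (S : V -> Prop) : V -> Prop :=
| span_gen v : S v -> span S v
| span0 : span S 0
| spanP c u v : span S u -> span S v -> span S (c *: u + v).

Definition in_span (S : V -> Prop) : {pred V} := fun v => `[< span S v >].

Lemma in_span_submod S : submod_closed (in_span S).
Proof.
split=> [|c u v /asboolP Su /asboolP Sv]; apply/asboolP; first exact: span0.
exact: spanP.
Qed.

HB.instance Definition _ S := GRing.isSubmodClosed.Build K V (in_span S)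
  (in_span_submod S).

End Span.

Section LinearExtension.
Context {K : fieldType} {T : choiceType} {V : lmodType K}.

Definition mlift (h : T -> V) (g : {malg K[T]}) : V :=
  \sum_(t <- msupp g) g@_t *: h t.

Lemma mliftEw (h : T -> V) (d : {fset T}) (g : {malg K[T]}) :
  (msupp g `<=` d)%fset -> mlift h g = \sum_(t <- d) g@_t *: h t.
Proof.
move=> le_gd; rewrite /mlift (big_fset_incl _ le_gd) // => t _.
by move/mcoeff_outdom ->; rewrite scale0r.
Qed.

Lemma mlift_is_linear h : linear (mlift h).
Proof.
move=> c g1 g2; pose d := (msupp g1 `|` msupp g2 `|` msupp (c *: g1 + g2))%fset.
have d1 : (msupp g1 `<=` d)%fset by rewrite /d -fsetUA fsubsetUl.
have d2 : (msupp g2 `<=` d)%fset by rewrite /d fsetUAC fsubsetUr.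
have d3 : (msupp (c *: g1 + g2) `<=` d)%fset by rewrite /d fsubsetUr.
rewrite (mliftEw h d1) (mliftEw h d2) (mliftEw h d3).
rewrite scaler_sumr -big_split; apply: eq_bigr => t _ /=.
by rewrite mcoeffD mcoeffZ scalerDl scalerA.
Qed.

HB.instance Definition _ h := GRing.isLinear.Build K {malg K[T]} V _ (mlift h)
  (mlift_is_linear h).

Lemma mliftU h t : mlift h << t >> = h t.
Proof. by rewrite /mlift msuppU oner_eq0 big_seq_fset1 mcoeffUU scale1r. Qed.

Lemma malg_span (g : {malg K[T]}) : g = \sum_(t <- msupp g) g@_t *: << t >>.
Proof.
rewrite {1}[g]monalgE; apply: eq_bigr => t _; apply/malgP => k.
by rewrite mcoeffZ !mcoeffU mulr_natr.
Qed.

Lemma malg_ext (f1 f2 : {malg K[T]} -> V) : linear f1 -> linear f2 ->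
  (forall t, f1 << t >> = f2 << t >>) -> f1 =1 f2.
Proof.
move=> l1 l2 e g.
pose L1 := GRing.isLinear.Build K _ V _ f1 l1.
pose L2 := GRing.isLinear.Build K _ V _ f2 l2.
pose F1 : {linear {malg K[T]} -> V} := HB.pack f1 L1.
pose F2 : {linear {malg K[T]} -> V} := HB.pack f2 L2.
rewrite -[f1 g]/(F1 g) -[f2 g]/(F2 g) [g]malg_span !linear_sum.
by apply: eq_bigr => t _; rewrite !linearZ /= e.
Qed.

End LinearExtension.

Section QuotientModule.
Context {K : fieldType} {V : lmodType K} (S : V -> Prop).

Definition lquot : Type := Quotient.quot (in_span S).

HB.instance Definition _ := GRing.Zmodule.on lquot.

Definition lpi (v : V) : lquot := \pi_(Quotient.quot (in_span S))%qT v.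
Definition lrepr (x : lquot) : V := repr (x : Quotient.quot (in_span S)).

Lemma lreprK : cancel lrepr lpi.
Proof. exact: reprK. Qed.

Lemma lpi_eq u v : (lpi u == lpi v) = (u - v \in in_span S).
Proof. by rewrite Quotient.idealrBE. Qed.

Lemma lpiD u v : lpi (u + v) = lpi u + lpi v.
Proof. exact: raddfD. Qed.

Definition lscale (c : K) (x : lquot) : lquot := lpi (c *: lrepr x).

Lemma lscale_pi c v : lscale c (lpi v) = lpi (c *: v).
Proof.
apply/eqP; rewrite lpi_eq -scalerBr rpredZ //.
by rewrite -lpi_eq lreprK.
Qed.

Lemma lscaleA a b x : lscale a (lscale b x) = lscale (a * b) x.
Proof. by rewrite -[x]lreprK !lscale_pi scalerA. Qed.

Lemma lscale1 : left_id 1 lscale.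
Proof. by move=> x; rewrite -[x]lreprK lscale_pi scale1r. Qed.

Lemma lscaleDr : right_distributive lscale +%R.
Proof.
move=> c x y; rewrite -[x]lreprK -[y]lreprK -lpiD !lscale_pi -lpiD.
by rewrite scalerDr.
Qed.

Lemma lscaleDl x : {morph lscale^~ x : a b / a + b}.
Proof. by move=> a b; rewrite -[x]lreprK !lscale_pi -lpiD scalerDl. Qed.

HB.instance Definition _ := GRing.Zmodule_isLmodule.Build K lquot
  lscaleA lscale1 lscaleDr lscaleDl.

Lemma lpi_is_linear : linear lpi.
Proof. by move=> c u v; rewrite lpiD -lscale_pi. Qed.

HB.instance Definition _ := GRing.isLinear.Build K V lquot _ lpi lpi_is_linear.

Lemma lpi_gen v : S v -> lpi v = 0.
Proof.
move=> Sv; rewrite -(linear0 lpi); apply/eqP; rewrite lpi_eq subr0.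
by apply/asboolP; apply: span_gen.
Qed.

Lemma lpi_rel u v : S (u - v) -> lpi u = lpi v.
Proof. by move=> Suv; apply/eqP; rewrite lpi_eq; apply/asboolP; apply: span_gen. Qed.

Section Lift.
Context {W : lmodType K}.

Definition lqlift (f : V -> W) (x : lquot) : W := f (lrepr x).

Lemma lqlift_pi (f : V -> W) v :
  linear f -> (forall u, S u -> f u = 0) -> lqlift f (lpi v) = f v.
Proof.
move=> lf fS.
have f0 : f 0 = 0 by have := lf (-1) 0 0; rewrite scaler0 addr0 scaleN1r addNr.
have kf u : span S u -> f u = 0.
  by elim=> // c u1 u2 _ e1 _ e2; rewrite lf e1 e2 scaler0 addr0.
apply/eqP; rewrite -subr_eq0 /lqlift addrC -scaleN1r -lf scaleN1r addrC.
apply/eqP/kf/asboolP; suff : lrepr (lpi v) - v \in in_span S by [].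
by rewrite -lpi_eq lreprK.
Qed.

End Lift.

End QuotientModule.

Section Tensor.
Context {K : fieldType}.

Inductive bilinear_rel (U V : lmodType K) : {malg K[(U * V)%type]} -> Prop :=
| bilinear_rell c u u' v :
    bilinear_rel (<< (c *: u + u', v) >> - (c *: << (u, v) >> + << (u', v) >>))
| bilinear_relr c u v v' :
    bilinear_rel (<< (u, c *: v + v') >> - (c *: << (u, v) >> + << (u, v') >>)).

Definition tens (U V : lmodType K) : Type := lquot (@bilinear_rel U V).

HB.instance Definition _ U V := GRing.Lmodule.on (tens U V).

Definition pure {U V : lmodType K} (u : U) (v : V) : tens U V :=
  lpi (@bilinear_rel U V) << (u, v) >>.

End Tensor.

Notation "U ⊗ V" := (tens U%type V%type) (at level 40, left associativity) : type_scope.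
Notation "u ⊗ v" := (pure u v) (at level 40, left associativity) : ring_scope.

Section TensorLift.
Context {K : fieldType}.

(* Total on all functions, so that Sweedler sums can be written without side
   conditions: t is replaced by some sum of pure tensors representing it.
   This is independent of the choice only when f is bilinear (tens_lift_pure). *)
Definition tens_lift {U V W : lmodType K} (f : U -> V -> W) (t : U ⊗ V) : W :=
  lqlift (mlift (fun p => f p.1 p.2)) t.

Definition bilin {U V W : lmodType K} (f : U -> V -> W) : Prop :=
  (forall v, linear (f^~ v)) /\ (forall u, linear (f u)).

Section Lift.
Context {U V W : lmodType K}.

Lemma pure_bilin : bilin (@pure K U V).
Proof.
split=> [v c u u'|u c v v'].
  by rewrite [LHS](lpi_rel (bilinear_rell c u u' v)) [LHS]lpi_is_linear.
by rewrite [LHS](lpi_rel (bilinear_relr c u v v')) [LHS]lpi_is_linear.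
Qed.

Lemma tens_lift_pi (f : U -> V -> W) (Bf : bilin f) g :
  tens_lift f (lpi (@bilinear_rel K U V) g) = mlift (fun p => f p.1 p.2) g.
Proof.
apply: lqlift_pi; first exact: mlift_is_linear.
move=> _ [c u u' v|c u v v']; rewrite linearB linearP /= !mliftU /=.
  by rewrite [f _ v]Bf.1 subrr.
by rewrite Bf.2 subrr.
Qed.

Lemma tens_lift_pure (f : U -> V -> W) (Bf : bilin f) u v :
  tens_lift f (u ⊗ v) = f u v.
Proof. by rewrite tens_lift_pi // mliftU. Qed.

Lemma tens_lift_linear (f : U -> V -> W) : bilin f -> linear (tens_lift f).
Proof.
move=> Bf c x y; rewrite -[x]lreprK -[y]lreprK.
by rewrite -[in LHS]lpi_is_linear !tens_lift_pi // mlift_is_linear.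
Qed.

Lemma tens_ext (f1 f2 : U ⊗ V -> W) : linear f1 -> linear f2 ->
  (forall u v, f1 (u ⊗ v) = f2 (u ⊗ v)) -> f1 =1 f2.
Proof.
move=> l1 l2 e x; rewrite -[x]lreprK.
move: (lrepr x); apply: malg_ext => [c u v|c u v|[u v]]; last exact: e.
  by rewrite lpi_is_linear l1.
by rewrite lpi_is_linear l2.
Qed.

End Lift.

End TensorLift.

Section TensorMaps.
Context {K : fieldType}.
Implicit Types U V W : lmodType K.

Definition tmap {U V U' V' : lmodType K} (f : U -> U') (g : V -> V') :
  U ⊗ V -> U' ⊗ V' := tens_lift (fun u v => f u ⊗ g v).

Definition tflip {U V : lmodType K} : U ⊗ V -> V ⊗ U :=
  tens_lift (fun u v => v ⊗ u).

Definition tassoc {U V W : lmodType K} : U ⊗ V ⊗ W -> U ⊗ (V ⊗ W) :=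
  tens_lift (fun x w => tens_lift (fun u v => u ⊗ (v ⊗ w)) x).

Definition tassocV {U V W : lmodType K} : U ⊗ (V ⊗ W) -> U ⊗ V ⊗ W :=
  tens_lift (fun u y => tens_lift (fun v w => u ⊗ v ⊗ w) y).

(* The two extensions of F to the threefold tensor power A ⊗ A ⊗ A. *)
Definition tleft {A : lmodType K} (F : A ⊗ A -> A ⊗ A) : A ⊗ A ⊗ A -> A ⊗ A ⊗ A :=
  tmap F id.

Definition tright {A : lmodType K} (F : A ⊗ A -> A ⊗ A) : A ⊗ A ⊗ A -> A ⊗ A ⊗ A :=
  tassocV \o tmap id F \o tassoc.

End TensorMaps.

Section TensorMapTheory.
Context {K : fieldType}.

Lemma linear_id (U : lmodType K) : linear (@id U).
Proof. by []. Qed.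

Lemma linear_comp {U V W : lmodType K} (f : V -> W) (g : U -> V) :
  linear f -> linear g -> linear (f \o g).
Proof. by move=> lf lg c x y; rewrite /= lg lf. Qed.

Lemma linear_comb {X W : lmodType K} (c : K) (f g : X -> W) :
  linear f -> linear g -> linear (fun x => c *: f x + g x).
Proof.
move=> lf lg d x y; rewrite lf lg !scalerDr addrACA !scalerA.
by rewrite [c * d]mulrC.
Qed.

Lemma linear_sumZ {U W : lmodType K} (f : U -> W) (I : finType) (c : I -> K)
    (u : I -> U) :
  linear f -> f (\sum_i c i *: u i) = \sum_i c i *: f (u i).
Proof.
move=> lf; pose L := GRing.isLinear.Build K _ W _ f lf.
pose F : {linear U -> W} := HB.pack f L.
by rewrite -[f]/(F : _ -> _) linear_sum; apply: eq_bigr => i _; rewrite linearZ.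
Qed.

Lemma linear_sumr {X W : lmodType K} (I : finType) (f : X -> I -> K) (w : I -> W) :
  (forall i, linear (fun x => f x i : K^o)) -> linear (fun x => \sum_i f x i *: w i).
Proof.
move=> lf c x y; rewrite scaler_sumr -big_split; apply: eq_bigr => i _.
by rewrite lf scalerDl scalerA.
Qed.

Lemma tens_lift_param {X U V W : lmodType K} (f : X -> U -> V -> W) :
  (forall x, bilin (f x)) -> (forall u v, linear (fun x => f x u v)) ->
  forall t, linear (fun x => tens_lift (f x) t).
Proof.
move=> Bf lf t c x y; move: t; apply: tens_ext.
- exact: tens_lift_linear.
- by apply: linear_comb; apply: tens_lift_linear.
- by move=> u v; rewrite !tens_lift_pure // lf.
Qed.

Section Maps.
Context {U V U' V' : lmodType K} (f : U -> U') (g : V -> V').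
Hypotheses (lf : linear f) (lg : linear g).

Lemma tmap_bilin : bilin (fun u v => f u ⊗ g v).
Proof.
split=> [v c u u'|u c v v'].
  by rewrite lf pure_bilin.1.
by rewrite lg pure_bilin.2.
Qed.

Lemma tmap_pure u v : tmap f g (u ⊗ v) = f u ⊗ g v.
Proof. by rewrite /tmap tens_lift_pure //; apply: tmap_bilin. Qed.

Lemma tmap_linear : linear (tmap f g).
Proof. exact: tens_lift_linear tmap_bilin. Qed.

End Maps.

Section Flip.
Context {U V : lmodType K}.

Let flip_bilin : bilin (fun (u : U) (v : V) => v ⊗ u).
Proof. by split=> [v|u]; [apply: pure_bilin.2 | apply: pure_bilin.1]. Qed.

Lemma tflip_pure (u : U) (v : V) : tflip (u ⊗ v) = v ⊗ u.
Proof. by rewrite /tflip tens_lift_pure. Qed.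

Lemma tflip_linear : linear (@tflip K U V).
Proof. exact: tens_lift_linear. Qed.

End Flip.

Section Assoc.
Context {U V W : lmodType K}.

Let Bi w : bilin (fun (u : U) (v : V) => u ⊗ (v ⊗ (w : W))).
Proof.
split=> [v|u c v v']; first exact: pure_bilin.1.
by rewrite pure_bilin.1 pure_bilin.2.
Qed.

Let Bo : bilin (fun x (w : W) => tens_lift (fun (u : U) (v : V) => u ⊗ (v ⊗ w)) x).
Proof.
split=> [w|x]; first exact: tens_lift_linear.
apply: tens_lift_param => // u v c w w'.
by rewrite !pure_bilin.2.
Qed.

Lemma tassoc_pure (u : U) (v : V) (w : W) : tassoc (u ⊗ v ⊗ w) = u ⊗ (v ⊗ w).
Proof. by rewrite /tassoc !tens_lift_pure. Qed.

Lemma tassoc_linear : linear (@tassoc K U V W).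
Proof. exact: tens_lift_linear. Qed.

Let BVi u : bilin (fun (v : V) (w : W) => (u : U) ⊗ v ⊗ w).
Proof.
split=> [w c v v'|v]; last exact: pure_bilin.2.
by rewrite pure_bilin.2 pure_bilin.1.
Qed.

Let BVo : bilin (fun (u : U) y => tens_lift (fun (v : V) (w : W) => u ⊗ v ⊗ w) y).
Proof.
split=> [y|u]; last exact: tens_lift_linear.
apply: tens_lift_param => // v w c u u'.
by rewrite !pure_bilin.1.
Qed.

Lemma tassocV_pure (u : U) (v : V) (w : W) : tassocV (u ⊗ (v ⊗ w)) = u ⊗ v ⊗ w.
Proof. by rewrite /tassocV !tens_lift_pure. Qed.

Lemma tassocV_linear : linear (@tassocV K U V W).
Proof. exact: tens_lift_linear. Qed.

Lemma tens_ext3 {X : lmodType K} (f1 f2 : U ⊗ V ⊗ W -> X) :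
  linear f1 -> linear f2 ->
  (forall u v w, f1 (u ⊗ v ⊗ w) = f2 (u ⊗ v ⊗ w)) -> f1 =1 f2.
Proof.
move=> l1 l2 e; apply: tens_ext => // x w; move: x.
apply: (tens_ext (f1 := fun x => f1 (x ⊗ w)) (f2 := fun x => f2 (x ⊗ w))) => //.
  by move=> c x y; rewrite pure_bilin.1 l1.
by move=> c x y; rewrite pure_bilin.1 l2.
Qed.

Lemma tens_ext3V {X : lmodType K} (f1 f2 : U ⊗ (V ⊗ W) -> X) :
  linear f1 -> linear f2 ->
  (forall u v w, f1 (u ⊗ (v ⊗ w)) = f2 (u ⊗ (v ⊗ w))) -> f1 =1 f2.
Proof.
move=> l1 l2 e; apply: tens_ext => // u y; move: y.
apply: (tens_ext (f1 := fun y => f1 (u ⊗ y)) (f2 := fun y => f2 (u ⊗ y))) => //.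
  by move=> c x y; rewrite pure_bilin.2 l1.
by move=> c x y; rewrite pure_bilin.2 l2.
Qed.

End Assoc.

Lemma tleft_linear {A : lmodType K} (F : A ⊗ A -> A ⊗ A) :
  linear F -> linear (tleft F).
Proof. by move=> lF; apply: tmap_linear => //; apply: linear_id. Qed.

Lemma tright_linear {A : lmodType K} (F : A ⊗ A -> A ⊗ A) :
  linear F -> linear (tright F).
Proof.
move=> lF; apply: linear_comp tassoc_linear.
by apply: linear_comp; [apply: tassocV_linear | apply: tmap_linear].
Qed.

End TensorMapTheory.

Section CEDS.
Context {K : fieldType}.

Definition braid_axiom {A : lmodType K} (F : A ⊗ A -> A ⊗ A) : Prop :=
  tright F \o tleft F \o tright F =1 tleft F \o tright tflip \o tleft F.

Definition lCEDS_axiom {A : lmodType K} (F : A ⊗ A -> A ⊗ A) : Prop :=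
  tright F \o tright tflip \o tleft tflip \o tleft F =1
  tleft tflip \o tleft F \o tright F \o tright tflip.

Definition dual_lCEDS_axiom {A : lmodType K} (F : A ⊗ A -> A ⊗ A) : Prop :=
  tleft F \o tleft tflip \o tright tflip \o tright F =1
  tright tflip \o tright F \o tleft F \o tleft tflip.

Record lCEDS (A : lmodType K) := LCEDS {
  lCEDS_map :> {linear (A ⊗ A)%type -> (A ⊗ A)%type};
  lCEDS_braid : braid_axiom lCEDS_map;
  lCEDS_ax : lCEDS_axiom lCEDS_map
}.

Record dual_lCEDS (A : lmodType K) := DualLCEDS {
  dual_lCEDS_map :> {linear (A ⊗ A)%type -> (A ⊗ A)%type};
  dual_lCEDS_braid : braid_axiom dual_lCEDS_map;
  dual_lCEDS_ax : dual_lCEDS_axiom dual_lCEDS_map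
}.

End CEDS.

Definition dualsp {K : fieldType} (E : vectType K) : vectType K := 'Hom(E, K^o).

Section Pairing.
Context {K : fieldType}.

Definition tpairing {U' V' U V : lmodType K} (p : U' -> U -> K^o)
    (q : V' -> V -> K^o) (w : U' ⊗ V') (t : U ⊗ V) : K^o :=
  tens_lift (fun u' v' => tens_lift (fun u v => (p u' u * q v' v : K^o)) t) w.

Lemma mul_bilin {U V : lmodType K} (p : U -> K^o) (q : V -> K^o) :
  linear p -> linear q -> bilin (fun u v => (p u * q v : K^o)).
Proof.
move=> lp lq; split=> [v c u u'|u c v v'].
  by rewrite lp mulrDl -mulrA.
by rewrite lq mulrDr mulrCA.
Qed.

Section Bilinear.
Context {U' V' U V : lmodType K} (p : U' -> U -> K^o) (q : V' -> V -> K^o).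
Hypotheses (Bp : bilin p) (Bq : bilin q).

Let Bi u' v' : bilin (fun u v => (p u' u * q v' v : K^o)).
Proof. exact: mul_bilin (Bp.2 u') (Bq.2 v'). Qed.

Let Bo t : bilin (fun u' v' =>
  tens_lift (fun u v => (p u' u * q v' v : K^o)) t).
Proof.
split=> [v'|u']; apply: tens_lift_param => // u v c x y.
  by rewrite Bp.1 mulrDl -mulrA.
by rewrite Bq.1 mulrDr mulrCA.
Qed.

Lemma tpairing_pure u' v' u v :
  tpairing p q (u' ⊗ v') (u ⊗ v) = p u' u * q v' v.
Proof. by rewrite /tpairing !tens_lift_pure. Qed.

Lemma tpairing_bilin : bilin (tpairing p q).
Proof.
split=> [t|w]; first exact: tens_lift_linear.
apply: tens_lift_param => [t|u' v']; first exact: Bo.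
exact: tens_lift_linear.
Qed.

End Bilinear.

Section Adjoint.
Context {U' V' W' U V W : lmodType K}.
Context (p : U' -> U -> K^o) (q : V' -> V -> K^o) (r : W' -> W -> K^o).
Hypotheses (Bp : bilin p) (Bq : bilin q) (Br : bilin r).

Lemma tmap_adj (f' : U' -> U') (g' : V' -> V') (f : U -> U) (g : V -> V) :
  linear f' -> linear g' -> linear f -> linear g ->
  (forall x y, p (f' x) y = p x (f y)) -> (forall x y, q (g' x) y = q x (g y)) ->
  forall w t, tpairing p q (tmap f' g' w) t = tpairing p q w (tmap f g t).
Proof.
move=> lf' lg' lf lg ef eg w t.
have [Bl Bt] := tpairing_bilin Bp Bq.
move: w; apply: tens_ext; [|exact: Bl|move=> u' v'].
  exact: linear_comp (Bl t) (tmap_linear lf' lg').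
move: t; apply: tens_ext; [exact: Bt| |move=> u v].
  exact: linear_comp (Bt _) (tmap_linear lf lg).
by rewrite (tmap_pure lf' lg') (tmap_pure lf lg) !(tpairing_pure Bp Bq) ef eg.
Qed.

Lemma tassoc_adj w t :
  tpairing p (tpairing q r) (tassoc w) t = tpairing (tpairing p q) r w (tassocV t).
Proof.
have [Bl Bt] := tpairing_bilin Bp (tpairing_bilin Bq Br).
have [Bl' Bt'] := tpairing_bilin (tpairing_bilin Bp Bq) Br.
move: w; apply: tens_ext3; [|exact: Bl'|move=> u' v' w'].
  exact: linear_comp (Bl t) tassoc_linear.
move: t; apply: tens_ext3V; [exact: Bt| |move=> u v w].
  exact: linear_comp (Bt' _) tassocV_linear.
rewrite tassoc_pure tassocV_pure !tpairing_pure ?mulrA //; exact: tpairing_bilin.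
Qed.

Lemma tassocV_adj w t :
  tpairing (tpairing p q) r (tassocV w) t = tpairing p (tpairing q r) w (tassoc t).
Proof.
have [Bl Bt] := tpairing_bilin Bp (tpairing_bilin Bq Br).
have [Bl' Bt'] := tpairing_bilin (tpairing_bilin Bp Bq) Br.
move: w; apply: tens_ext3V; [|exact: Bl|move=> u' v' w'].
  exact: linear_comp (Bl' t) tassocV_linear.
move: t; apply: tens_ext3; [exact: Bt'| |move=> u v w].
  exact: linear_comp (Bt _) tassoc_linear.
rewrite tassoc_pure tassocV_pure !tpairing_pure ?mulrA //; exact: tpairing_bilin.
Qed.

Lemma tflip_adj w t : tpairing p p (tflip w) t = tpairing p p w (tflip t).
Proof.
have [Bl Bt] := tpairing_bilin Bp Bp.
move: w; apply: tens_ext; [|exact: Bl|move=> u' v'].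
  exact: linear_comp (Bl t) tflip_linear.
move: t; apply: tens_ext; [exact: Bt| |move=> u v].
  exact: linear_comp (Bt _) tflip_linear.
by rewrite !tflip_pure !tpairing_pure // mulrC.
Qed.

End Adjoint.

Definition frame {U' U : lmodType K} (p : U' -> U -> K^o) {I : finType}
    (e : I -> U) (e' : I -> U') : Prop :=
  forall u', u' = \sum_i (p u' (e i) : K) *: e' i.

Lemma frame_inj {U' U : lmodType K} (p : U' -> U -> K^o) {I : finType}
    (e : I -> U) (e' : I -> U') :
  frame p e e' -> forall w w', (forall t, p w t = p w' t) -> w = w'.
Proof. by move=> fr w w' e1; rewrite (fr w) (fr w'); apply: eq_bigr => i _; rewrite e1. Qed.

Lemma tframe {U' U V' V : lmodType K} (p : U' -> U -> K^o) (q : V' -> V -> K^o)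
    {I J : finType} (e : I -> U) (e' : I -> U') (f : J -> V) (f' : J -> V') :
  bilin p -> bilin q -> frame p e e' -> frame q f f' ->
  frame (tpairing p q) (fun ij : I * J => e ij.1 ⊗ f ij.2)
    (fun ij : I * J => e' ij.1 ⊗ f' ij.2).
Proof.
move=> Bp Bq fp fq; apply: tens_ext; first exact: linear_id.
  by apply: linear_sumr => ij; apply: (tpairing_bilin Bp Bq).1.
move=> u' v'; rewrite [in LHS](fp u') [in LHS](fq v').
rewrite (linear_sumZ _ _ (pure_bilin.1 _)).
under eq_bigr => i _ do rewrite (linear_sumZ _ _ (pure_bilin.2 _)) scaler_sumr.
rewrite pair_big; apply: eq_bigr => ij _ /=.
by rewrite scalerA tpairing_pure.
Qed.

Lemma frame_flip {U' U V' V : lmodType K} (p : U' -> U -> K^o) (q : V' -> V -> K^o) w t :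
  bilin p -> bilin q ->
  tpairing (fun x y => p y x) (fun x y => q y x) t w = tpairing p q w t.
Proof.
move=> Bp Bq.
have Bp' : bilin (fun x y => p y x) by split; [apply: Bp.2 | apply: Bp.1].
have Bq' : bilin (fun x y => q y x) by split; [apply: Bq.2 | apply: Bq.1].
have [Bl Bt] := tpairing_bilin Bp Bq.
have [Bl' Bt'] := tpairing_bilin Bp' Bq'.
move: w; apply: tens_ext => // u' v'.
move: t; apply: tens_ext => // u v.
by rewrite !tpairing_pure.
Qed.

Section Transpose.
Context {A : vectType K}.

Definition ev (f : dualsp A) (x : A) : K^o := f x.

Definition bas (i : 'I_(\dim {:A})) : A := (vbasis {:A})`_i.
Definition cobas (i : 'I_(\dim {:A})) : dualsp A :=
  linfun (coord (vbasis {:A}) i : A -> K^o).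

Lemma ev_bilin : bilin ev.
Proof.
split=> [x c f g|f c x y]; last exact: linearP.
by rewrite /ev add_lfunE scale_lfunE.
Qed.

Lemma bas_frame : frame (fun x f => ev f x) cobas bas.
Proof.
move=> x; rewrite {1}(coord_vbasis (memvf x)); apply: eq_bigr => i _.
by rewrite /ev lfunE.
Qed.

Lemma cobas_frame : frame ev bas cobas.
Proof.
move=> f; apply/lfunP => x; rewrite {1}(bas_frame x) linear_sum sum_lfunE.
by apply: eq_bigr => i _; rewrite linearZ scale_lfunE; apply: mulrC.
Qed.

Local Notation P2 := (tpairing ev ev).
Local Notation P3 := (tpairing P2 ev).

Let B2 := tpairing_bilin ev_bilin ev_bilin.
Let B3 := tpairing_bilin B2 ev_bilin.

(* The transpose of F, through (A ⊗ A)^* = A^* ⊗ A^*: see transposeE. *)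
Definition transpose_map (F : A ⊗ A -> A ⊗ A) (w : dualsp A ⊗ dualsp A) :
    dualsp A ⊗ dualsp A :=
  \sum_(ij : 'I_(\dim {:A}) * 'I_(\dim {:A}))
    (P2 w (F (bas ij.1 ⊗ bas ij.2)) : K) *: (cobas ij.1 ⊗ cobas ij.2).

Lemma transpose_is_linear F : linear (transpose_map F).
Proof. by apply: linear_sumr => ij; apply: B2.1. Qed.

HB.instance Definition _ F := GRing.isLinear.Build K _ _ _ (transpose_map F)
  (transpose_is_linear F).

Lemma transposeE F w t : linear F -> P2 (transpose_map F w) t = P2 w (F t).
Proof.
move=> lF; rewrite (linear_sumZ _ _ (B2.1 _)).
have Bv : bilin (fun x (f : dualsp A) => ev f x).
  by split; [apply: ev_bilin.2 | apply: ev_bilin.1].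
rewrite [in RHS](tframe Bv Bv bas_frame bas_frame t) linear_sumZ //.
rewrite (linear_sumZ _ _ (B2.2 _)); apply: eq_bigr => ij _.
by rewrite (frame_flip _ _ ev_bilin ev_bilin); apply: mulrC.
Qed.

Section Adjoints.
Variables (F' : dualsp A ⊗ dualsp A -> dualsp A ⊗ dualsp A) (F : A ⊗ A -> A ⊗ A).
Hypotheses (lF' : linear F') (lF : linear F).
Hypothesis F'E : forall w t, P2 (F' w) t = P2 w (F t).

Lemma tleft_adj w t : P3 (tleft F' w) t = P3 w (tleft F t).
Proof. exact: (tmap_adj B2 ev_bilin lF' (@linear_id _ _) lF (@linear_id _ _)). Qed.

Lemma tright_adj w t : P3 (tright F' w) t = P3 w (tright F t).
Proof.
have B := ev_bilin.
by rewrite /tright /= tassocV_adj // (tmap_adj B B2 (@linear_id _ _) lF' (@linear_id _ _) lF) // tassoc_adj.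
Qed.

End Adjoints.

Lemma P3_inj w w' : (forall t, P3 w t = P3 w' t) -> w = w'.
Proof.
apply: frame_inj; apply: tframe; [exact: B2|exact: ev_bilin| |exact: cobas_frame].
by apply: tframe; try exact: ev_bilin; exact: cobas_frame.
Qed.

Section TransposeCEDS.
Variable F : lCEDS A.

Definition adjoint3 (G' : dualsp A ⊗ dualsp A ⊗ dualsp A -> dualsp A ⊗ dualsp A ⊗ dualsp A)
  (G : A ⊗ A ⊗ A -> A ⊗ A ⊗ A) := forall w t, P3 (G' w) t = P3 w (G t).

Lemma adjoint3_comp G' G H' H :
  adjoint3 G' G -> adjoint3 H' H -> adjoint3 (G' \o H') (H \o G).
Proof. by move=> aG aH w t; rewrite /comp aG aH. Qed.

Lemma adjoint3_eq G1' G1 G2' G2 :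
  adjoint3 G1' G1 -> adjoint3 G2' G2 -> G1 =1 G2 -> G1' =1 G2'.
Proof. by move=> a1 a2 e w; apply: P3_inj => t; rewrite a1 a2 e. Qed.

Let lF : linear F. Proof. exact: linearP. Qed.
Let lF' := transpose_is_linear F.
Let FE w t := transposeE w t lF.
Let fE := tflip_adj ev_bilin.
Let l0 : linear (@tflip K A A) := tflip_linear.
Let l0' : linear (@tflip K (dualsp A) (dualsp A)) := tflip_linear.
Let aL : adjoint3 (tleft (transpose_map F)) (tleft F) := tleft_adj lF' lF FE.
Let aR : adjoint3 (tright (transpose_map F)) (tright F) := tright_adj lF' lF FE.
Let aLt : adjoint3 (tleft tflip) (tleft tflip) := tleft_adj l0' l0 fE.
Let aRt : adjoint3 (tright tflip) (tright tflip) := tright_adj l0' l0 fE.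

Lemma transpose_braid : braid_axiom (transpose_map F).
Proof.
exact: (adjoint3_eq (adjoint3_comp (adjoint3_comp aR aL) aR)
  (adjoint3_comp (adjoint3_comp aL aRt) aL) (lCEDS_braid F)).
Qed.

Lemma transpose_dual : dual_lCEDS_axiom (transpose_map F).
Proof.
apply: (adjoint3_eq
  (adjoint3_comp (adjoint3_comp (adjoint3_comp aL aLt) aRt) aR)
  (adjoint3_comp (adjoint3_comp (adjoint3_comp aRt aR) aL) aLt)).
exact: (lCEDS_ax F).
Qed.

Definition transpose : dual_lCEDS (dualsp A) :=
  DualLCEDS transpose_braid transpose_dual.

End TransposeCEDS.

End Transpose.

End Pairing.

(* Symmetric operads, in the finite-set ("partial composition") presentation:
   P X is the space of operations whose inputs are labelled by the finite type
   X, so that P 'I_n, with its action of the permutations of 'I_n, is the space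
   of n-ary operations.  To compose b : P Y into the input x of a : P X, and
   name the inputs of the result by Z, one identifies Z with the disjoint union
   of X \ {x} and Y, along f on X \ {x} and g on Y; f x is irrelevant. *)
Definition grafting {X Y Z : finType} (x : X) (f : X -> Z) (g : Y -> Z) : Prop :=
  [/\ {in predC1 x &, injective f}, injective g,
      forall x' y, x' != x -> f x' != g y &
      forall z, (exists2 x', x' != x & f x' = z) \/ exists y, g y = z].

Record operad (K : fieldType) := Operad {
  op_sp :> finType -> lmodType K;
  op_map : forall (X Y : finType) (f : X -> Y), bijective f -> op_sp X -> op_sp Y;
  op_one : op_sp unit;
  op_comp : forall (X Y Z : finType) (x : X) (f : X -> Z) (g : Y -> Z),
    grafting x f g -> op_sp X -> op_sp Y -> op_sp Z;
  op_map_linear : forall (X Y : finType) (f : X -> Y) (Bf : bijective f), linear (op_map Bf);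
  op_comp_bilin : forall (X Y Z : finType) (x : X) (f : X -> Z) (g : Y -> Z)
    (G : grafting x f g), bilin (op_comp G);
  op_map_id : forall (X : finType) (B : bijective (@id X)) a, op_map B a = a;
  op_map_comp : forall (X Y Z : finType) (f : X -> Y) (g : Y -> Z) (Bf : bijective f)
    (Bg : bijective g) (Bgf : bijective (g \o f)) a,
    op_map Bgf a = op_map Bg (op_map Bf a);
  op_comp_ext : forall (X Y Z : finType) (x : X) (f f' : X -> Z) (g : Y -> Z)
    (G : grafting x f g) (G' : grafting x f' g) a b,
    {in predC1 x, f =1 f'} -> op_comp G a b = op_comp G' a b;
  op_comp_map : forall (X Y X' Y' Z Z' : finType) (x : X) (k : X -> X') (l : Y -> Y')
    (h : Z -> Z') (f : X' -> Z) (g : Y' -> Z)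
    (Bk : bijective k) (Bl : bijective l) (Bh : bijective h)
    (G : grafting (k x) f g) (G' : grafting x (h \o f \o k) (h \o g \o l)) a b,
    op_comp G' a b = op_map Bh (op_comp G (op_map Bk a) (op_map Bl b));
  op_comp_onel : forall (Y Z : finType) (f : unit -> Z) (g : Y -> Z)
    (G : grafting tt f g) (Bg : bijective g) b,
    op_comp G op_one b = op_map Bg b;
  op_comp_oner : forall (X Z : finType) (x : X) (f : X -> Z) (g : unit -> Z)
    (G : grafting x f g) (Bf : bijective f) a,
    f x = g tt -> op_comp G a op_one = op_map Bf a;
  op_comp_seq : forall (X Y Z W V T : finType) (x : X) (y : Y)
    (h : Y -> W) (k : Z -> W) (f : X -> T) (g : W -> T)
    (f1 : X -> V) (g1 : Y -> V) (f2 : V -> T) (g2 : Z -> T)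
    (G1 : grafting y h k) (G2 : grafting x f g)
    (H1 : grafting x f1 g1) (H2 : grafting (g1 y) f2 g2) a b c,
    {in predC1 x, f =1 f2 \o f1} -> {in predC1 y, g \o h =1 f2 \o g1} ->
    g \o k =1 g2 ->
    op_comp G2 a (op_comp G1 b c) = op_comp H2 (op_comp H1 a b) c;
  op_comp_par : forall (X Y Z V W T : finType) (x x' : X)
    (f : X -> V) (g : Y -> V) (h : V -> T) (k : Z -> T)
    (f' : X -> W) (g' : Z -> W) (h' : W -> T) (k' : Y -> T)
    (G : grafting x f g) (H : grafting (f x') h k)
    (G' : grafting x' f' g') (H' : grafting (f' x) h' k') a b c,
    x' != x -> {in [predC pred2 x x'], h \o f =1 h' \o f'} ->
    h \o g =1 k' -> k =1 h' \o g' ->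
    op_comp H (op_comp G a b) c = op_comp H' (op_comp G' a c) b
}.
Arguments op_map {K} o {X Y f}.
Arguments op_one {K} o.
Arguments op_comp {K} o {X Y Z x f g}.
Arguments op_map_linear {K} o { X Y f}.
Arguments op_comp_bilin {K} o { X Y Z x f g}.
Arguments op_map_id {K o X}.
Arguments op_map_comp {K o X Y Z f g}.
Arguments op_comp_ext {K o X Y Z x f f' g}.
Arguments op_comp_map {K o X Y X' Y' Z Z' x k l h f g}.
Arguments op_comp_onel {K o Y Z f g}.
Arguments op_comp_oner {K o X Z x f g}.
Arguments op_comp_seq {K o X Y Z W V T x y h k f g f1 g1 f2 g2}.
Arguments op_comp_par {K o X Y Z V W T x x' f g h k f' g' h' k'}.

Definition operad_iso {K : fieldType} (P Q : operad K) : Prop :=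
  exists F : forall X : finType, P X -> Q X,
  [/\ forall X, linear (F X), forall X, bijective (F X),
      forall (X Y : finType) (f : X -> Y) (Bf : bijective f) a,
        F Y (op_map P Bf a) = op_map Q Bf (F X a),
      F unit (op_one P) = op_one Q &
      forall (X Y Z : finType) (x : X) (f : X -> Z) (g : Y -> Z)
        (G : grafting x f g) a b,
        F Z (op_comp P G a b) = op_comp Q G (F X a) (F Y b)].

Section QuotientOperad.
Context {K : fieldType} (P : operad K) (S : forall X : finType, P X -> Prop).

Inductive op_ideal : forall X : finType, P X -> Prop :=
| ideal_gen (X : finType) a : @S X a -> @op_ideal X a
| ideal0 (X : finType) : @op_ideal X 0
| idealP (X : finType) c a b : @op_ideal X a -> @op_ideal X b -> @op_ideal X (c *: a + b)
| ideal_map (X Y : finType) (f : X -> Y) (Bf : bijective f) a :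
    @op_ideal X a -> @op_ideal Y (op_map P Bf a)
| ideal_compl (X Y Z : finType) (x : X) (f : X -> Z) (g : Y -> Z) (G : grafting x f g) a b :
    @op_ideal X a -> @op_ideal Z (op_comp P G a b)
| ideal_compr (X Y Z : finType) (x : X) (f : X -> Z) (g : Y -> Z) (G : grafting x f g) a b :
    @op_ideal Y b -> @op_ideal Z (op_comp P G a b).

Lemma span_ideal X a : span (@op_ideal X) a -> op_ideal a.
Proof. by elim=> [//||c u v _ iu _ iv]; [apply: ideal0 | apply: idealP]. Qed.

Definition quot_sp (X : finType) : lmodType K := lquot (@op_ideal X).

Definition qcls {X} (a : P X) : quot_sp X := lpi (@op_ideal X) a.

Lemma qcls_linear X : linear (@qcls X).
Proof. exact: lpi_is_linear. Qed.

Lemma qclsP X (u : quot_sp X) : exists a, u = qcls a.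
Proof. by exists (lrepr u); rewrite /qcls lreprK. Qed.

Definition quot_map (X Y : finType) (f : X -> Y) (Bf : bijective f)
  (u : quot_sp X) : quot_sp Y := qcls (op_map P Bf (lrepr u)).

Definition quot_comp (X Y Z : finType) (x : X) (f : X -> Z) (g : Y -> Z)
  (G : grafting x f g) (u : quot_sp X) (v : quot_sp Y) : quot_sp Z :=
  qcls (op_comp P G (lrepr u) (lrepr v)).

Lemma linearBB {U V : lmodType K} (f : U -> V) : linear f ->
  forall u v, f (u - v) = f u - f v.
Proof. by move=> lf u v; rewrite addrC -scaleN1r lf scaleN1r addrC. Qed.

Lemma lrepr_qcls X (a : P X) : op_ideal (lrepr (qcls a) - a).
Proof.
apply: span_ideal; apply/asboolP.
suff: lrepr (qcls a) - a \in in_span (@op_ideal X) by [].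
by rewrite -lpi_eq lreprK.
Qed.

Lemma quot_map_cls (X Y : finType) (f : X -> Y) (Bf : bijective f) a :
  quot_map Bf (qcls a) = qcls (op_map P Bf a).
Proof.
apply: lpi_rel; rewrite -(linearBB (op_map_linear P Bf)).
exact/ideal_map/lrepr_qcls.
Qed.

Lemma quot_comp_cls (X Y Z : finType) (x : X) (f : X -> Z) (g : Y -> Z)
  (G : grafting x f g) a b :
  quot_comp G (qcls a) (qcls b) = qcls (op_comp P G a b).
Proof.
have [Bl Br] := op_comp_bilin P G.
transitivity (qcls (op_comp P G (lrepr (qcls a)) b)); apply: lpi_rel.
  by rewrite -(linearBB (Br _)); apply/ideal_compr/lrepr_qcls.
by rewrite -(linearBB (Bl b)); apply/ideal_compl/lrepr_qcls.
Qed.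

Definition quot_operad : operad K.
Proof.
refine (@Operad K quot_sp quot_map (qcls (op_one P)) quot_comp
  _ _ _ _ _ _ _ _ _ _).
- move=> X Y f Bf c u v; have [a ->] := qclsP u; have [b ->] := qclsP v.
  by rewrite -qcls_linear !quot_map_cls (op_map_linear P Bf) qcls_linear.
- move=> X Y Z x f g G; have [Bl Br] := op_comp_bilin P G.
  split=> [v c u u'|u c v v'].
    have [a ->] := qclsP u; have [a' ->] := qclsP u'; have [b ->] := qclsP v.
    by rewrite -qcls_linear !quot_comp_cls Bl qcls_linear.
  have [a ->] := qclsP v; have [a' ->] := qclsP v'; have [b ->] := qclsP u.
  by rewrite -qcls_linear !quot_comp_cls Br qcls_linear.
- by move=> X B u; have [a ->] := qclsP u; rewrite quot_map_cls op_map_id.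
- move=> X Y Z f g Bf Bg Bgf u; have [a ->] := qclsP u.
  by rewrite !quot_map_cls (op_map_comp Bf Bg).
- move=> X Y Z x f f' g G G' u v e; have [a ->] := qclsP u.
  have [b ->] := qclsP v.
  by rewrite !quot_comp_cls (op_comp_ext G G' a b e).
- move=> X Y X' Y' Z Z' x k l h f g Bk Bl Bh G G' u v.
  have [a ->] := qclsP u; have [b ->] := qclsP v.
  by rewrite (quot_map_cls Bk) (quot_map_cls Bl) !quot_comp_cls quot_map_cls -op_comp_map.
- move=> Y Z f g G Bg v; have [b ->] := qclsP v.
  by rewrite quot_comp_cls quot_map_cls -(op_comp_onel G).
- move=> X Z x f g G Bf u e; have [a ->] := qclsP u.
  by rewrite quot_comp_cls quot_map_cls (op_comp_oner G Bf).
- move=> X Y Z W V T x y h k f g f1 g1 f2 g2 G1 G2 H1 H2 u v w e1 e2 e3.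
  have [a ->] := qclsP u; have [b ->] := qclsP v; have [c ->] := qclsP w.
  by rewrite !quot_comp_cls (op_comp_seq G1 G2 H1 H2 a b c e1 e2 e3).
- move=> X Y Z V W T x x' f g h k f' g' h' k' G H G' H' u v w e1 e2 e3 e4.
  have [a ->] := qclsP u; have [b ->] := qclsP v; have [c ->] := qclsP w.
  by rewrite !quot_comp_cls (op_comp_par G H G' H' a b c e1 e2 e3 e4).
Defined.

End QuotientOperad.

Section Trees.

Inductive tree (E X : Type) : Type :=
| Leaf of X
| Node of E & tree E X & tree E X.
Arguments Leaf {E X}.

HB.instance Definition _ E X := gen_eqMixin (tree E X).
HB.instance Definition _ E X := gen_choiceMixin (tree E X).

Context {E : Type}.

Fixpoint leaves {X : Type} (t : tree E X) : seq X :=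
  match t with
  | Leaf x => [:: x]
  | Node _ l r => leaves l ++ leaves r
  end.

Fixpoint subst {X Y : Type} (h : X -> tree E Y) (t : tree E X) : tree E Y :=
  match t with
  | Leaf x => h x
  | Node e l r => Node e (subst h l) (subst h r)
  end.

Definition relabel {X Y : Type} (f : X -> Y) : tree E X -> tree E Y :=
  subst (fun x => Leaf (f x)).

Definition graft {X Y Z : finType} (x : X) (f : X -> Z) (g : Y -> Z)
    (t : tree E X) (s : tree E Y) : tree E Z :=
  subst (fun x' => if x' == x then relabel g s else Leaf (f x')) t.

Definition linear_tree {X : finType} (t : tree E X) : bool :=
  [forall x, count_mem x (leaves t) == 1%N].

Lemma eq_subst {X Y : Type} (h h' : X -> tree E Y) :
  h =1 h' -> subst h =1 subst h'.
Proof. by move=> e; elim=> //= x l -> r ->. Qed.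

Lemma subst_leaf {X : Type} (t : tree E X) : subst Leaf t = t.
Proof. by elim: t => //= e l -> r ->. Qed.

Lemma subst_subst {X Y Z : Type} (h : X -> tree E Y) (k : Y -> tree E Z) t :
  subst k (subst h t) = subst (subst k \o h) t.
Proof. by elim: t => //= e l -> r ->. Qed.

Lemma leaves_subst {X Y : Type} (h : X -> tree E Y) t :
  leaves (subst h t) = flatten [seq leaves (h x) | x <- leaves t].
Proof.
elim: t => [x|e l IHl r IHr] /=; first by rewrite cats0.
by rewrite map_cat flatten_cat IHl IHr.
Qed.

Lemma count_subst {X Y : finType} (h : X -> tree E Y) t y : linear_tree t ->
  count_mem y (leaves (subst h t)) = (\sum_x count_mem y (leaves (h x)))%N.
Proof.
move/forallP => lt; rewrite leaves_subst count_flatten -map_comp sumnE big_map.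
rewrite (@perm_big _ _ _ _ _ (enum X)) ?big_enum //=.
apply/allP => x _; rewrite /= (eqP (lt x)) count_uniq_mem ?enum_uniq //.
by rewrite mem_enum.
Qed.

Lemma relabel_linear {X Y : finType} (f : X -> Y) t :
  bijective f -> linear_tree t -> linear_tree (relabel f t).
Proof.
move=> [f' fK f'K] lt; apply/forallP => y; rewrite count_subst //.
rewrite (bigD1 (f' y)) //= f'K eqxx big1 // => x ne.
by case: eqP => // e; move: ne; rewrite -e fK eqxx.
Qed.

Lemma graft_linear {X Y Z : finType} (x : X) (f : X -> Z) (g : Y -> Z) t s :
  grafting x f g -> linear_tree t -> linear_tree s -> linear_tree (graft x f g t s).
Proof.
move=> [fI gI fg cov] lt ls; apply/forallP => z; rewrite count_subst //.
rewrite (bigD1 x) //= eqxx count_subst //=.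
have [[x1 ne1 <-]|[y <-]] := cov z.
  rewrite [X in (X + _)%N]big1 => [|y _]; last by rewrite eq_sym (negPf (fg _ _ ne1)).
  rewrite (bigD1 x1) //= (negPf ne1) /= eqxx big1 // => x2 /andP[ne2 ne21].
  rewrite (negPf ne2) /=; case: eqP => // /fI e.
  by rewrite e ?eqxx // in ne21.
rewrite (bigD1 y) //= eqxx big1 => [|y1 ne1]; last first.
  by case: eqP => // /gI e; rewrite e eqxx in ne1.
rewrite big1 // => x1 ne1; rewrite (negPf ne1) /=.
by rewrite (negPf (fg _ _ ne1)).
Qed.

Lemma relabel_comp {X Y Z : Type} (f : X -> Y) (g : Y -> Z) t :
  relabel g (relabel f t) = relabel (g \o f) t.
Proof. exact: subst_subst. Qed.

Lemma subst_relabel {X Y Z : Type} (f : X -> Y) (h : Y -> tree E Z) t :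
  subst h (relabel f t) = subst (h \o f) t.
Proof. exact: subst_subst. Qed.

Lemma relabel_subst {X Y Z : Type} (h : X -> tree E Y) (f : Y -> Z) t :
  relabel f (subst h t) = subst (relabel f \o h) t.
Proof. exact: subst_subst. Qed.

Lemma eq_relabel {X Y : Type} (f g : X -> Y) :
  f =1 g -> relabel f =1 relabel g.
Proof. by move=> e; apply: eq_subst => x; rewrite e. Qed.

End Trees.
Arguments Leaf {E X}.

Section LinearTrees.
Context {E : Type} {X : finType}.

Record ltree := LTree { ltree_val :> tree E X; _ : linear_tree ltree_val }.
HB.instance Definition _ := [isSub for ltree_val].
HB.instance Definition _ := [Choice of ltree by <:].

End LinearTrees.
Arguments ltree : clear implicits.

(* The operad freely generated by operations e(-,-), e : E, with no relation:
   P X has for basis the planar binary trees with vertices decorated by E and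
   leaves labelled bijectively by X. *)
Section TreeOperad.
Context {K : fieldType} {E : Type}.

Definition tree_sp (X : finType) : lmodType K := {malg K[ltree E X]}.

Definition ltree_map (X Y : finType) (f : X -> Y) (Bf : bijective f)
    (t : ltree E X) : ltree E Y :=
  LTree (relabel_linear Bf (valP t)).

Definition ltree_comp (X Y Z : finType) (x : X) (f : X -> Z) (g : Y -> Z)
    (G : grafting x f g) (t : ltree E X) (s : ltree E Y) : ltree E Z :=
  LTree (graft_linear G (valP t) (valP s)).

Lemma leaf_tt_linear : linear_tree (Leaf tt : tree E unit).
Proof. by apply/forallP => -[]. Qed.

Definition tree_map (X Y : finType) (f : X -> Y) (Bf : bijective f) :
    tree_sp X -> tree_sp Y :=
  mlift (fun t => << ltree_map Bf t >>).

Definition tree_comp (X Y Z : finType) (x : X) (f : X -> Z) (g : Y -> Z)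
    (G : grafting x f g) (a : tree_sp X) (b : tree_sp Y) : tree_sp Z :=
  mlift (fun t => mlift (fun s => << ltree_comp G t s >>) b) a.

Lemma tree_mapU (X Y : finType) (f : X -> Y) (Bf : bijective f) t :
  tree_map Bf << t >> = << ltree_map Bf t >>.
Proof. exact: mliftU. Qed.

Lemma tree_compU (X Y Z : finType) (x : X) (f : X -> Z) (g : Y -> Z)
    (G : grafting x f g) t s :
  tree_comp G << t >> << s >> = << ltree_comp G t s >>.
Proof. by rewrite /tree_comp !mliftU. Qed.

Lemma tree_map_linear (X Y : finType) (f : X -> Y) (Bf : bijective f) :
  linear (tree_map Bf).
Proof. exact: mlift_is_linear. Qed.

Lemma mlift_param {T : choiceType} {U V : lmodType K} (h : U -> T -> V) :
  (forall t, linear (h^~ t)) -> forall a, linear (fun u => mlift (h u) a).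
Proof.
move=> lh a c u v; move: a; apply: malg_ext; first exact: mlift_is_linear.
  by apply: linear_comb; apply: mlift_is_linear.
by move=> t; rewrite !mliftU lh.
Qed.

Lemma tree_comp_bilin (X Y Z : finType) (x : X) (f : X -> Z) (g : Y -> Z)
    (G : grafting x f g) : bilin (tree_comp G).
Proof.
split=> [b|a]; first exact: mlift_is_linear.
by apply: mlift_param => t; apply: mlift_is_linear.
Qed.

Lemma malg_ext2 {T1 T2 : choiceType} {W : lmodType K}
    (f1 f2 : {malg K[T1]} -> {malg K[T2]} -> W) : bilin f1 -> bilin f2 ->
  (forall s t, f1 << s >> << t >> = f2 << s >> << t >>) -> forall a b, f1 a b = f2 a b.
Proof.
move=> [l1 r1] [l2 r2] e a b; move: a; apply: malg_ext => // s.
by move: b; apply: malg_ext.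
Qed.

Lemma malg_ext3 {T1 T2 T3 : choiceType} {W : lmodType K}
    (f1 f2 : {malg K[T1]} -> {malg K[T2]} -> {malg K[T3]} -> W) :
  (forall c, bilin (fun a b => f1 a b c)) -> (forall a b, linear (f1 a b)) ->
  (forall c, bilin (fun a b => f2 a b c)) -> (forall a b, linear (f2 a b)) ->
  (forall r s t, f1 << r >> << s >> << t >> = f2 << r >> << s >> << t >>) ->
  forall a b c, f1 a b c = f2 a b c.
Proof.
move=> l1 r1 l2 r2 e a b c.
apply: (malg_ext2 (f1 := fun a b => f1 a b c) (f2 := fun a b => f2 a b c)) => // r s.
by move: c; apply: malg_ext.
Qed.

Definition tree_operad : operad K.
Proof.
refine (@Operad K tree_sp (@tree_map) << LTree leaf_tt_linear >> (@tree_comp)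
  _ _ _ _ _ _ _ _ _ _).
- exact: tree_map_linear.
- exact: tree_comp_bilin.
- move=> X B; apply: malg_ext; [exact: tree_map_linear|exact: linear_id|move=> t].
  by rewrite tree_mapU; congr (<< _ >>); apply: val_inj; apply: subst_leaf.
- move=> X Y Z f g Bf Bg Bgf; apply: malg_ext; first exact: tree_map_linear.
    exact: linear_comp (tree_map_linear Bg) (tree_map_linear Bf).
  move=> t; rewrite !tree_mapU; congr (<< _ >>); apply: val_inj => /=.
  by rewrite relabel_comp.
- move=> X Y Z x f f' g G G' a b e; move: a b.
  apply: malg_ext2; [exact: tree_comp_bilin|exact: tree_comp_bilin|move=> t s].
  rewrite !tree_compU; congr (<< _ >>); apply: val_inj; apply: eq_subst => x' /=.
  by case: (altP (x' =P x)) => // ne; rewrite e.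
- move=> X Y X' Y' Z Z' x k l h f g Bk Bl Bh G G'.
  have [Bc1 Bc2] := tree_comp_bilin G.
  apply: malg_ext2; first exact: tree_comp_bilin.
    split=> [b|a]; apply: (linear_comp (tree_map_linear Bh)).
      exact: linear_comp (Bc1 _) (tree_map_linear Bk).
    exact: linear_comp (Bc2 _) (tree_map_linear Bl).
  move=> t s; rewrite !tree_mapU !tree_compU tree_mapU.
  congr (<< _ >>); apply: val_inj; rewrite /= /graft relabel_subst subst_relabel.
  apply: eq_subst => x' /=; rewrite (bij_eq Bk); case: eqP => // _.
  by rewrite !relabel_comp.
- move=> Y Z f g G Bg; apply: malg_ext; [|exact: tree_map_linear|move=> t].
    exact: (tree_comp_bilin G).2.
  by rewrite tree_compU tree_mapU; congr (<< _ >>); apply: val_inj.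
- move=> X Z x f g G Bf a e; move: a; apply: malg_ext; [|exact: tree_map_linear|move=> t].
    exact: (tree_comp_bilin G).1.
  rewrite tree_compU tree_mapU; congr (<< _ >>); apply: val_inj.
  by apply: eq_subst => x' /=; case: eqP => // ->; rewrite e.
- move=> X Y Z W V T x y h k f g f1 g1 f2 g2 G1 G2 H1 H2 a b c e1 e2 e3; move: a b c.
  have [BG1 BG2 BH1 BH2] := And4 (tree_comp_bilin G1) (tree_comp_bilin G2)
    (tree_comp_bilin H1) (tree_comp_bilin H2).
  apply: malg_ext3.
  + by move=> c; split=> [b|a]; [apply: BG2.1 | apply: linear_comp (BG2.2 _) (BG1.1 _)].
  + by move=> a b; apply: linear_comp (BG2.2 _) (BG1.2 _).
  + move=> c; split=> [b|a]; first exact: linear_comp (BH2.1 _) (BH1.1 _).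
    exact: linear_comp (BH2.1 _) (BH1.2 _).
  + by move=> a b; apply: BH2.2.
  move=> t s r; rewrite !tree_compU; congr (<< _ >>); apply: val_inj => /=.
  rewrite /graft subst_subst; apply: eq_subst => x' /=.
  have [_ g1I fg1 _] := H1.
  case: (altP (x' =P x)) => [_|ne]; last first.
    by rewrite /= (negPf (fg1 _ _ ne)) -[f2 _]/((f2 \o f1) x') -e1.
  rewrite relabel_subst subst_relabel; apply: eq_subst => y' /=.
  rewrite (inj_eq g1I); case: (altP (y' =P y)) => [_|ne].
    by rewrite relabel_comp; apply: eq_relabel.
  by rewrite -[f2 _]/((f2 \o g1) y') -e2.
- move=> X Y Z V W T x x' f g h k f' g' h' k' G H G' H' a b c ne e1 e2 e3; move: a b c.
  have [BG BH BG' BH'] := And4 (tree_comp_bilin G) (tree_comp_bilin H)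
    (tree_comp_bilin G') (tree_comp_bilin H').
  apply: malg_ext3.
  + move=> c; split=> [b|a]; first exact: linear_comp (BH.1 _) (BG.1 _).
    exact: linear_comp (BH.1 _) (BG.2 _).
  + by move=> a b; apply: BH.2.
  + by move=> c; split=> [b|a]; [apply: linear_comp (BH'.1 _) (BG'.1 _) | apply: BH'.2].
  + by move=> a b; apply: linear_comp (BH'.1 _) (BG'.2 _).
  move=> t s r; rewrite !tree_compU; congr (<< _ >>); apply: val_inj => /=.
  rewrite /graft !subst_subst; apply: eq_subst => x1 /=.
  have [fI _ fg _] := G; have [fI' _ fg' _] := G'.
  have ne' : x != x' by rewrite eq_sym.
  case: (altP (x1 =P x)) => [->|ne1].
    rewrite (negPf ne') /= eqxx subst_relabel; apply: eq_subst => y /=.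
    by rewrite eq_sym (negPf (fg _ _ ne)) -e2.
  case: (altP (x1 =P x')) => [->|ne2] /=.
    rewrite eqxx subst_relabel; apply: eq_subst => z /=.
    by rewrite eq_sym (negPf (fg' _ _ ne')) e3.
  rewrite (inj_in_eq fI) ?inE // (negPf ne2) (inj_in_eq fI') ?inE // (negPf ne1).
  by have /= -> := e1 x1 _; rewrite ?inE ?negb_or ?ne1.
Defined.

End TreeOperad.
Arguments tree_operad : clear implicits.

(* Binary generators: s2_act exchanges the two inputs. *)
Record s2mod (K : fieldType) := S2mod {
  s2_sp :> vectType K;
  s2_act : {linear s2_sp -> s2_sp};
  s2_actK : involutive s2_act
}.
Arguments s2_act {K s}.

Section SignDual.
Context {K : fieldType} (E : s2mod K).

Definition sgn_dual_act (f : dualsp E) : dualsp E :=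
  linfun (fun x => - f (s2_act x) : K^o).

Lemma sgn_dual_actE f x : sgn_dual_act f x = - f (s2_act x).
Proof.
have L : linear (fun x => - f (s2_act x) : K^o).
  by move=> c u v; rewrite [in LHS]linearP [in LHS]linearP /= opprD scalerN.
pose M := GRing.isLinear.Build K _ _ _ _ L.
pose F : {linear E -> K^o} := HB.pack (fun x => - f (s2_act x) : K^o) M.
by rewrite /sgn_dual_act (lfunE F).
Qed.

Lemma sgn_dual_act_is_linear : linear sgn_dual_act.
Proof.
move=> c f g; apply/lfunP => x; rewrite add_lfunE scale_lfunE !sgn_dual_actE.
by rewrite add_lfunE scale_lfunE opprD scalerN.
Qed.

HB.instance Definition _ := GRing.isLinear.Build K _ _ _ sgn_dual_act
  sgn_dual_act_is_linear.

Lemma sgn_dual_actK : involutive sgn_dual_act.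
Proof. by move=> f; apply/lfunP => x; rewrite !sgn_dual_actE opprK s2_actK. Qed.

Definition sgn_dual : s2mod K := S2mod sgn_dual_actK.

End SignDual.

(* The module A ⊗ K[S_2]: (a, 0) is the operation (x, y) |-> x *_a y
   and (0, a) is (x, y) |-> y *_a x. *)
Section FreeS2.
Context {K : fieldType} (A : vectType K).

Definition swap_act (u : A * A) : A * A := (u.2, u.1).

Lemma swap_act_is_linear : linear swap_act.
Proof. by []. Qed.

HB.instance Definition _ := GRing.isLinear.Build K _ _ _ swap_act swap_act_is_linear.

Lemma swap_actK : involutive swap_act.
Proof. by case. Qed.

Definition free_s2 : s2mod K := @S2mod K (A * A)%type swap_act swap_actK.

End FreeS2.

Section FreeOperad.
Context {K : fieldType} (E : s2mod K).

(* The basis vector of a tree; trees whose leaves are not in bijection with X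
   give the junk value 0. *)
Definition tree_vec {X : finType} (t : tree E X) : tree_operad K E X :=
  if insub t is Some u then << u >> else 0.

Definition corolla (e : E) (i j : bool) : tree_operad K E bool :=
  tree_vec (Node e (Leaf i) (Leaf j)).

Inductive corolla_rel : forall X : finType, tree_operad K E X -> Prop :=
| corolla_linear c e e' : corolla_rel
    (corolla (c *: e + e') false true
     - (c *: corolla e false true + corolla e' false true))
| corolla_act e :
    corolla_rel (corolla (s2_act e) false true - corolla e true false).

Definition free_operad : operad K := quot_operad corolla_rel.

Definition free_tree {X : finType} (t : tree E X) : free_operad X :=
  qcls corolla_rel (tree_vec t).

Lemma free_corolla_linear :
  linear (fun e => qcls corolla_rel (corolla e false true)).
Proof.
move=> c e e'; rewrite -qcls_linear; apply: lpi_rel.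
exact: ideal_gen (corolla_linear c e e').
Qed.

Lemma tree_vecE {X : finType} (t : tree E X) (lt : linear_tree t) :
  tree_vec t = << LTree lt >>.
Proof.
rewrite /tree_vec; case: insubP => [u _ e|]; last by rewrite lt.
by congr (<< _ >>); apply: val_inj.
Qed.

Lemma corolla_tree_linear e : linear_tree (Node e (Leaf false) (Leaf true) : tree E bool).
Proof. by apply/forallP => -[]. Qed.

Section Bilinearity.
Context {X : finType} (i j k : X).

Let g (b : bool) : X := if b then j else i.

Lemma free_tree_bilinl (G : grafting false (fun=> k) g) :
  bilin (fun e e' => free_tree (Node e (Node e' (Leaf i) (Leaf j)) (Leaf k))).
Proof.
have E1 e e' : free_tree (Node e (Node e' (Leaf i) (Leaf j)) (Leaf k)) =
    op_comp free_operad G (qcls corolla_rel (corolla e false true))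
      (qcls corolla_rel (corolla e' false true)).
  rewrite [RHS]quot_comp_cls /corolla !(tree_vecE (corolla_tree_linear _)).
  rewrite [op_comp _ _ _ _]tree_compU /free_tree.
  have lt := valP (ltree_comp G (LTree (corolla_tree_linear e)) (LTree (corolla_tree_linear e'))).
  by rewrite (tree_vecE lt); congr qcls; congr (<< _ >>); apply: val_inj.
have [Bl Br] := op_comp_bilin free_operad G.
split=> [e' c e1 e2|e c e1 e2]; rewrite !E1 free_corolla_linear.
  exact: Bl.
exact: Br.
Qed.

Lemma free_tree_bilinr (G : grafting true (fun=> k) g) :
  bilin (fun e e' => free_tree (Node e (Leaf k) (Node e' (Leaf i) (Leaf j)))).
Proof.
have E1 e e' : free_tree (Node e (Leaf k) (Node e' (Leaf i) (Leaf j))) =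
    op_comp free_operad G (qcls corolla_rel (corolla e false true))
      (qcls corolla_rel (corolla e' false true)).
  rewrite [RHS]quot_comp_cls /corolla !(tree_vecE (corolla_tree_linear _)).
  rewrite [op_comp _ _ _ _]tree_compU /free_tree.
  have lt := valP (ltree_comp G (LTree (corolla_tree_linear e)) (LTree (corolla_tree_linear e'))).
  by rewrite (tree_vecE lt); congr qcls; congr (<< _ >>); apply: val_inj.
have [Bl Br] := op_comp_bilin free_operad G.
split=> [e' c e1 e2|e c e1 e2]; rewrite !E1 free_corolla_linear.
  exact: Bl.
exact: Br.
Qed.

End Bilinearity.

Inductive S3_span (R : free_operad 'I_3 -> Prop) : free_operad 'I_3 -> Prop :=
| S3_span_gen r : R r -> S3_span R r
| S3_span0 : S3_span R 0
| S3_spanP c r s : S3_span R r -> S3_span R s -> S3_span R (c *: r + s)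
| S3_span_perm (f : 'I_3 -> 'I_3) (Bf : bijective f) r :
    S3_span R r -> S3_span R (op_map free_operad Bf r).

(* The identification of three copies of E ⊗ E with the arity 3 component:
   e ⊗ e' in the copy indexed by k is the operation e(e'(x_{k+1}, x_{k+2}), x_k),
   indices modulo 3.  These cyclic representatives (xy)z, (yz)x, (zx)y are those
   for which weight2_pairing below is S_3-invariant up to the sign. *)
Definition weight2 : Type := {ffun 'I_3 -> E ⊗ E}.

Definition weight2_op (v : weight2) : free_operad 'I_3 :=
  \sum_k tens_lift (fun e e' : E => free_tree
    (Node e (Node e' (Leaf (ordS k)) (Leaf (ordS (ordS k)))) (Leaf k))) (v k).

End FreeOperad.

Definition weight2_pairing {K : fieldType} {E : s2mod K}
    (v : weight2 (sgn_dual E)) (u : weight2 E) : K :=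
  \sum_k tpairing ev ev (v k) (u k).

Record quadratic (K : fieldType) := Quadratic {
  quad_gen : s2mod K;
  quad_rel : free_operad quad_gen 'I_3 -> Prop
}.

Section Presented.
Context {K : fieldType} (D : quadratic K).

Inductive quad_ideal_gen : forall X : finType, free_operad (quad_gen D) X -> Prop :=
| Quad_ideal_gen r : quad_rel r -> quad_ideal_gen r.

Definition quad_operad : operad K := quot_operad quad_ideal_gen.

Definition orthogonal_rel (y : free_operad (sgn_dual (quad_gen D)) 'I_3) : Prop :=
  exists2 v, y = weight2_op v &
    forall u, S3_span (@quad_rel K D) (weight2_op u) -> weight2_pairing v u = 0.

Definition koszul_dual : quadratic K := Quadratic orthogonal_rel.

End Presented.

Section Operads.
Context {K : fieldType}.

Section Ops.
Context {A : vectType K}.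

Definition prod_op {X : Type} (a : A) (s t : tree (free_s2 A) X) :
  tree (free_s2 A) X := @Node (free_s2 A) X (a, 0) s t.

End Ops.

Local Notation x := (Leaf (0 : 'I_3)).
Local Notation y := (Leaf (1 : 'I_3)).
Local Notation z := (Leaf (2 : 'I_3)).

(* c and d stand for the two Sweedler components of F (a ⊗ b): c = a' -> b' and
   d = a'' |> b''. *)
Inductive prelie_rel {A : vectType K} (F : lCEDS A) :
    free_operad (free_s2 A) 'I_3 -> Prop :=
| Prelie_rel a b : prelie_rel F (
    (free_tree (prod_op a x (prod_op b y z))
     - tens_lift (fun c d => free_tree (prod_op c (prod_op d x y) z)) (F (a ⊗ b)))
  - (free_tree (prod_op b y (prod_op a x z))
     - tens_lift (fun c d => free_tree (prod_op c (prod_op d y x) z)) (F (b ⊗ a)))).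

Definition PreLie {A : vectType K} (F : lCEDS A) : quadratic K :=
  Quadratic (prelie_rel F).

Inductive perm_rel {B : vectType K} (G : dual_lCEDS B) :
    free_operad (free_s2 B) 'I_3 -> Prop :=
| Perm_rel_assoc a b : perm_rel G (
    free_tree (prod_op a (prod_op b x y) z)
    - tens_lift (fun c d => free_tree (prod_op c x (prod_op d y z))) (G (a ⊗ b)))
| Perm_rel_comm a b : perm_rel G (
    free_tree (prod_op a x (prod_op b y z)) - free_tree (prod_op b y (prod_op a x z))).

Definition Perm {B : vectType K} (G : dual_lCEDS B) : quadratic K :=
  Quadratic (perm_rel G).

End Operads.

(* Main.v *)
Require Import Defs.
From HB Require Import structures.
From mathcomp Require Import all_boot all_order all_algebra.
From mathcomp Require Import finmap boolp monalg zify.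
Set Implicit Arguments.
Unset Strict Implicit.
Unset Printing Implicit Defensive.
Import GRing.Theory.
Local Open Scope ring_scope.

(** Up to a sign, the sign-twisted dual of the generators of PreLie_Phi is the
    module of generators of Perm_(Phi^* ), so both operads are quotients of the
    same free operad, and it remains to identify the ideals of relations.  The
    permutative relations rewrite every weight 2 operation into a sum over k of
    operations e(e'(x_(k+1), x_(k+2)), x_k) with e and e' both reversed, hence
    into three tensors in A^* ⊗ A^* (perm_normal).  The pairings of a weight 2
    operation with the translates of the prelie relations are, up to sign,
    exactly the values of these tensors on A ⊗ A, so being orthogonal to the
    prelie relations and being zero modulo the permutative ones are the same.
    That a pairing is a well-defined function on the free operad is shown by
    evaluating trees in a three-step graded algebra (weight_alg). *)

(** * Consequences of linearity for functions that are not bundled as linear maps *)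

Section LinearFunctions.
Context {K : fieldType} {U V : lmodType K} (f : U -> V).
Hypothesis lf : linear f.

Let F : {linear U -> V} := HB.pack f (GRing.isLinear.Build K U V _ f lf).

Lemma linear_fun0 : f 0 = 0. Proof. exact: (linear0 F). Qed.
Lemma linear_funD : {morph f : x y / x + y}. Proof. exact: (linearD F). Qed.
Lemma linear_funN : {morph f : x / - x}. Proof. exact: (linearN F). Qed.
Lemma linear_funZ c : {morph f : x / c *: x}. Proof. by move=> x; apply: (linearZ_LR F). Qed.
Lemma linear_fun_sum (I : Type) (r : seq I) (P : pred I) (u : I -> U) :
  f (\sum_(i <- r | P i) u i) = \sum_(i <- r | P i) f (u i).
Proof. exact: (linear_sum F). Qed.

End LinearFunctions.

(** * Operad morphisms and the maps they induce on quotient operads *)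

Section OperadHom.
Context {K : fieldType}.

Record operad_hom (P Q : operad K) (F : forall X : finType, P X -> Q X) : Prop := OperadHom {
  hom_linear : forall X, linear (F X);
  hom_map : forall (X Y : finType) (f : X -> Y) (Bf : bijective f) a,
    F Y (op_map P Bf a) = op_map Q Bf (F X a);
  hom_one : F unit (op_one P) = op_one Q;
  hom_comp : forall (X Y Z : finType) (x : X) (f : X -> Z) (g : Y -> Z)
    (G : grafting x f g) a b, F Z (op_comp P G a b) = op_comp Q G (F X a) (F Y b)
}.

(** An operadic ideal is already a subspace in each arity, so the span taken to form the quotient
    adds nothing to it. *)
Lemma qcls_eq0 (P : operad K) (S : forall X : finType, P X -> Prop) (X : finType) (a : P X) :
  qcls S a = 0 <-> op_ideal S a.
Proof.
split=> [e|Sa]; last exact: lpi_gen.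
apply: span_ideal; apply/asboolP; suff: a - 0 \in in_span (@op_ideal K P S X) by rewrite subr0.
by rewrite -lpi_eq -/(qcls S a) e -[0](linear_fun0 (qcls_linear S (X := X))).
Qed.

Lemma qcls_hom (P : operad K) (S : forall X : finType, P X -> Prop) :
  @operad_hom P (quot_operad S) (fun X => @qcls K P S X).
Proof.
split=> //; first exact: qcls_linear.
  by move=> X Y f Bf a; rewrite -[RHS]/(quot_map Bf _) quot_map_cls.
by move=> X Y Z x f g G a b; rewrite -[RHS]/(quot_comp G _ _) quot_comp_cls.
Qed.

Section Induced.
Context {P Q : operad K} (F : forall X : finType, P X -> Q X) (hF : operad_hom F).
Context (S : forall X : finType, P X -> Prop) (T : forall X : finType, Q X -> Prop).
Hypothesis FS : forall X a, @S X a -> op_ideal T (F a).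

(** The elements that a morphism sends into an ideal form an ideal themselves, so it is enough to
    test the generators. *)
Lemma hom_ideal X a : @op_ideal K P S X a -> op_ideal T (F a).
Proof.
have [lF mF _ cF] := hF.
elim=> {X a} [|X|X c a b _ IHa _ IHb|X Y f Bf a _ IH|X Y Z x f g G a b _ IH|X Y Z x f g G a b _ IH].
- exact: FS.
- by rewrite (linear_fun0 (lF X)); apply: ideal0.
- by rewrite lF; apply: idealP.
- by rewrite mF; apply: ideal_map.
- by rewrite cF; apply: ideal_compl.
- by rewrite cF; apply: ideal_compr.
Qed.

(** Computed on a chosen representative; [quot_hom_cls] shows that the choice does not matter. *)
Definition quot_hom (X : finType) (u : quot_operad S X) : quot_operad T X :=
  qcls T (F (lrepr u)).

Lemma quot_hom_cls (X : finType) (a : P X) : quot_hom (qcls S a) = qcls T (F a).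
Proof.
apply: lpi_rel; rewrite -(linearBB (hom_linear hF (X := X))).
exact/hom_ideal/lrepr_qcls.
Qed.

Lemma quot_hom_is_hom : operad_hom quot_hom.
Proof.
have [lP mP oP cP] := qcls_hom S; have [lQ mQ oQ cQ] := qcls_hom T.
have [lF mF oF cF] := hF.
split=> [X c u v|X Y f Bf u||X Y Z x f g G u v].
- have [a ->] := qclsP u; have [b ->] := qclsP v.
  by rewrite -lP !quot_hom_cls lF lQ.
- have [a ->] := qclsP u.
  by rewrite -mP !quot_hom_cls mF mQ.
- by rewrite -oP quot_hom_cls oF oQ.
- have [a ->] := qclsP u; have [b ->] := qclsP v.
  by rewrite -cP !quot_hom_cls cF cQ.
Qed.

End Induced.

Lemma quot_hom_can {P Q : operad K} (F : forall X : finType, P X -> Q X)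
    (G : forall X : finType, Q X -> P X) (hF : operad_hom F) (hG : operad_hom G)
    (S : forall X : finType, P X -> Prop) (T : forall X : finType, Q X -> Prop) :
  (forall X a, S X a -> op_ideal T (F X a)) -> (forall X a, T X a -> op_ideal S (G X a)) ->
  (forall X, cancel (@F X) (@G X)) ->
  forall X, cancel (@quot_hom P Q F S T X) (@quot_hom Q P G T S X).
Proof.
move=> FS GT FK X u; have [a ->] := qclsP u.
by rewrite (quot_hom_cls hF FS) (quot_hom_cls hG GT) FK.
Qed.

(** Mutually inverse morphisms which send the generators of each ideal into the other ideal descend
    to mutually inverse morphisms. The theorem follows from this with two free operads for [P] and
    [Q], and the two sets of relations for [S] and [T]. *)
Lemma quot_operad_iso {P Q : operad K} (F : forall X : finType, P X -> Q X)
    (G : forall X : finType, Q X -> P X) (hF : operad_hom F) (hG : operad_hom G)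
    (S : forall X : finType, P X -> Prop) (T : forall X : finType, Q X -> Prop) :
  (forall X a, S X a -> op_ideal T (F X a)) -> (forall X a, T X a -> op_ideal S (G X a)) ->
  (forall X, cancel (@F X) (@G X)) -> (forall X, cancel (@G X) (@F X)) ->
  operad_iso (quot_operad S) (quot_operad T).
Proof.
move=> FS GT FK GK; exists (quot_hom F (S := S) T).
have [l m o c] := quot_hom_is_hom hF FS.
split=> // X; exists (quot_hom G (S := T) S (X := X)).
  exact: (quot_hom_can hF hG FS GT FK).
exact: (quot_hom_can hG hF GT FS GK).
Qed.

End OperadHom.

(** * Changing the decorations of trees *)

Section Decorate.
Context {E E' : Type} (phi : E -> E').

Fixpoint decorate {X : Type} (t : tree E X) : tree E' X :=
  match t with
  | Leaf x => Leaf x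
  | Node e l r => Node (phi e) (decorate l) (decorate r)
  end.

Lemma leaves_decorate {X : Type} (t : tree E X) : leaves (decorate t) = leaves t.
Proof. by elim: t => //= e l -> r ->. Qed.

Lemma linear_decorate {X : finType} (t : tree E X) :
  linear_tree (decorate t) = linear_tree t.
Proof. by rewrite /linear_tree leaves_decorate. Qed.

Lemma decorate_subst {X Y : Type} (h : X -> tree E Y) (t : tree E X) :
  decorate (subst h t) = subst (decorate \o h) (decorate t).
Proof. by elim: t => //= e l -> r ->. Qed.

Definition ltree_decorate {X : finType} (t : ltree E X) : ltree E' X :=
  LTree (etrans (linear_decorate t) (valP t)).

Context {K : fieldType}.

Definition tree_decorate (X : finType) : tree_operad K E X -> tree_operad K E' X :=
  mlift (fun t => << ltree_decorate t >>).

Lemma tree_decorateU (X : finType) (t : ltree E X) :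
  tree_decorate << t >> = << ltree_decorate t >>.
Proof. exact: mliftU. Qed.

Lemma tree_decorate_hom : operad_hom tree_decorate.
Proof.
have lF X : linear (@tree_decorate X) by apply: mlift_is_linear.
split=> //.
- move=> X Y f Bf; apply: malg_ext.
  + exact: linear_comp (lF _) (tree_map_linear Bf).
  + exact: linear_comp (tree_map_linear Bf) (lF _).
  + move=> t; rewrite [op_map _ _ _]tree_mapU !tree_decorateU [RHS]tree_mapU.
    by congr (<< _ >>); apply: val_inj; rewrite /= decorate_subst.
- by rewrite tree_decorateU; congr (<< _ >>); apply: val_inj.
- move=> X Y Z x f g G.
  have [Bl Br] := tree_comp_bilin (K := K) (E := E) G.
  have [Bl' Br'] := tree_comp_bilin (K := K) (E := E') G.
  apply: malg_ext2.
  + split=> [b|a]; first exact: linear_comp (lF _) (Bl b).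
    exact: linear_comp (lF _) (Br a).
  + split=> [b|a]; first exact: linear_comp (Bl' _) (lF _).
    exact: linear_comp (Br' _) (lF _).
  + move=> t s; rewrite [op_comp _ _ _ _]tree_compU !tree_decorateU [RHS]tree_compU.
    congr (<< _ >>); apply: val_inj; rewrite /= decorate_subst.
    by apply: eq_subst => x' /=; case: eqP => // _; rewrite decorate_subst.
Qed.

End Decorate.

Lemma decorate_comp {E E' E'' : Type} (phi : E -> E') (psi : E' -> E'') (X : Type)
    (t : tree E X) : decorate psi (decorate phi t) = decorate (psi \o phi) t.
Proof. by elim: t => //= e l -> r ->. Qed.

Lemma decorate_id {E : Type} (X : Type) (t : tree E X) : decorate id t = t.
Proof. by elim: t => //= e l -> r ->. Qed.

Lemma eq_decorate {E E' : Type} (phi psi : E -> E') (X : Type) :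
  phi =1 psi -> @decorate _ _ phi X =1 decorate psi.
Proof. by move=> e; elim=> //= a l -> r ->; rewrite e. Qed.

Lemma tree_decorate_can {K : fieldType} {E E' : Type} (phi : E -> E') (psi : E' -> E) :
  cancel phi psi ->
  forall X, cancel (@tree_decorate E E' phi K X) (@tree_decorate E' E psi K X).
Proof.
move=> phiK X; apply: malg_ext; last 1 first.
- move=> t; rewrite !tree_decorateU; congr (<< _ >>); apply: val_inj => /=.
  by rewrite decorate_comp (eq_decorate phiK) decorate_id.
- by apply: linear_comp; apply: mlift_is_linear.
- exact: linear_id.
Qed.

(** * Free operads: functoriality in the generators, and trees with three leaves *)

Section FreeOperadTheory.
Context {K : fieldType}.

Lemma free_tree_map {E : s2mod K} {X Y : finType} (f : X -> Y) (Bf : bijective f)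
    (t : tree E X) : linear_tree t ->
  op_map (free_operad E) Bf (free_tree t) = free_tree (relabel f t).
Proof.
move=> lt; rewrite -(hom_map (qcls_hom (@corolla_rel K E))) /free_tree.
rewrite (tree_vecE lt) (tree_vecE (relabel_linear Bf lt)) [op_map _ _ _]tree_mapU.
by congr qcls; congr (<< _ >>); apply: val_inj.
Qed.

Lemma free_tree_comp {E : s2mod K} {X Y Z : finType} (x : X) (f : X -> Z) (g : Y -> Z)
    (G : grafting x f g) (t : tree E X) (s : tree E Y) : linear_tree t -> linear_tree s ->
  op_comp (free_operad E) G (free_tree t) (free_tree s) = free_tree (graft x f g t s).
Proof.
move=> lt ls; rewrite -(hom_comp (qcls_hom (@corolla_rel K E))) /free_tree.
rewrite (tree_vecE lt) (tree_vecE ls) (tree_vecE (graft_linear G lt ls)).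
rewrite [op_comp _ _ _ _]tree_compU.
by congr qcls; congr (<< _ >>); apply: val_inj.
Qed.

Section FreeMap.
Context {E E' : s2mod K} (phi : E -> E').
Hypotheses (lphi : linear phi) (phi_act : forall e, phi (s2_act e) = s2_act (phi e)).

(** Decoration does not change the leaves, so a tree with the junk value 0 is sent to a tree with
    the junk value 0. *)
Lemma tree_decorate_vec (X : finType) (t : tree E X) :
  tree_decorate phi (tree_vec t) = tree_vec (decorate phi t).
Proof.
rewrite /tree_vec; case: insubP => [u _ e|/negPf nlt].
  rewrite tree_decorateU; case: insubP => [u' _ e'|]; last first.
    by rewrite linear_decorate -e (valP u).
  by congr (<< _ >>); apply: val_inj; rewrite /= e' e.
by rewrite insubF ?linear_decorate // (linear_fun0 (hom_linear (tree_decorate_hom phi) (X := X))).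
Qed.

(** Linearity of [phi] preserves the relations [corolla_linear], and equivariance preserves the
    relations [corolla_act]. *)
Lemma corolla_rel_decorate (X : finType) (a : tree_operad K E X) :
  corolla_rel a -> op_ideal (@corolla_rel K E') (tree_decorate phi a).
Proof.
have lF Y := hom_linear (tree_decorate_hom phi) (K := K) (X := Y).
case=> [c e e'|e]; apply: ideal_gen; rewrite (linearBB (lF _)).
  by rewrite lF !tree_decorate_vec /= lphi; apply: corolla_linear.
by rewrite !tree_decorate_vec /= phi_act; apply: corolla_act.
Qed.

Definition free_map : forall X : finType, free_operad E X -> free_operad E' X :=
  @quot_hom _ _ _ (tree_decorate phi) (@corolla_rel K E) (@corolla_rel K E').

Lemma free_map_hom : operad_hom free_map.
Proof. exact: (quot_hom_is_hom (tree_decorate_hom phi) corolla_rel_decorate). Qed.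

Lemma free_map_tree (X : finType) (t : tree E X) :
  free_map (free_tree t) = free_tree (decorate phi t).
Proof.
rewrite [LHS](quot_hom_cls (tree_decorate_hom phi) corolla_rel_decorate).
by rewrite tree_decorate_vec.
Qed.

End FreeMap.

Lemma free_map_can {E E' : s2mod K} (phi : E -> E') (psi : E' -> E) :
  linear phi -> (forall e, phi (s2_act e) = s2_act (phi e)) ->
  linear psi -> (forall e, psi (s2_act e) = s2_act (psi e)) ->
  cancel phi psi -> forall X, cancel (@free_map _ _ phi X) (@free_map _ _ psi X).
Proof.
move=> lphi sphi lpsi spsi phiK; apply: quot_hom_can; try exact: tree_decorate_hom.
- exact: corolla_rel_decorate.
- exact: corolla_rel_decorate.
- exact: tree_decorate_can.
Qed.

(** An enumeration of a set with exactly three elements. Stating the arity 3 lemmas for any such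
    enumeration covers all orders of the inputs at once. *)
Definition three_inputs {X : finType} (i j k : X) : Prop :=
  uniq [:: i; j; k] /\ (forall z, z \in [:: i; j; k]).

Section ThreeInputs.
Context {E : s2mod K} {X : finType} (i j k : X).
Hypothesis ijk : three_inputs i j k.

Let g (b : bool) : X := if b then j else i.

(** Grafting data for inserting one corolla into the input [x] of another: the inner inputs become
    [i] and [j], the remaining outer input becomes [k]. Identities between corollas thus carry over
    to trees with three leaves. *)
Lemma grafting3 (x : bool) : grafting x (fun=> k) g.
Proof.
have [/= /andP[]] := ijk; rewrite !inE negb_or => /andP[nij nik].
rewrite andbT => njk cov.
split.
- by move=> [] []; case: x.
- by move=> [] [] //= e; move: nij; rewrite e eqxx.
- by move=> x' [] _ /=; rewrite eq_sym.
- move=> z; have := cov z; rewrite !inE => /or3P[] /eqP ->.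
  + by right; exists false.
  + by right; exists true.
  + by left; exists (~~ x) => //; case: x.
Qed.

Lemma corolla_lin (e : E) (b : bool) :
  linear_tree (Node e (Leaf b) (Leaf (~~ b)) : tree E bool).
Proof. by apply/forallP => -[]; case: b. Qed.

Lemma linear_comb3 (e e' : E) :
  linear_tree (Node e (Node e' (Leaf i) (Leaf j)) (Leaf k)).
Proof. exact: (graft_linear (grafting3 false) (corolla_lin e false) (corolla_lin e' false)). Qed.

Lemma linear_comb3r (e e' : E) :
  linear_tree (Node e (Leaf k) (Node e' (Leaf i) (Leaf j))).
Proof. exact: (graft_linear (grafting3 true) (corolla_lin e false) (corolla_lin e' false)). Qed.

Lemma free_corolla_act (e : E) :
  free_tree (Node (s2_act e) (Leaf false) (Leaf true)) = free_tree (Node e (Leaf true) (Leaf false)).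
Proof. exact/lpi_rel/ideal_gen/corolla_act. Qed.

(** Both sides are the same composition along [grafting3 false], whose outer corolla is written in
    the two ways identified by [free_corolla_act]. *)
Lemma free_tree_root_act (e e' : E) :
  free_tree (Node (s2_act e) (Node e' (Leaf i) (Leaf j)) (Leaf k)) =
  free_tree (Node e (Leaf k) (Node e' (Leaf i) (Leaf j))).
Proof.
have := free_tree_comp (grafting3 false) (corolla_lin (s2_act e) false) (corolla_lin e' false).
have := free_tree_comp (grafting3 false) (corolla_lin e true) (corolla_lin e' false).
by rewrite /= free_corolla_act => -> ->.
Qed.

Lemma free_tree_inner_act (e e' : E) :
  free_tree (Node e (Node (s2_act e') (Leaf i) (Leaf j)) (Leaf k)) =
  free_tree (Node e (Node e' (Leaf j) (Leaf i)) (Leaf k)).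
Proof.
have := free_tree_comp (grafting3 false) (corolla_lin e false) (corolla_lin (s2_act e') false).
have := free_tree_comp (grafting3 false) (corolla_lin e false) (corolla_lin e' true).
by rewrite /= free_corolla_act => -> ->.
Qed.

Lemma free_tree3_bilin :
  bilin (fun e e' : E => free_tree (Node e (Node e' (Leaf i) (Leaf j)) (Leaf k))).
Proof. exact: free_tree_bilinl (grafting3 false). Qed.

End ThreeInputs.

End FreeOperadTheory.

(** * Evaluation of operations in an algebra over the free operad *)

Section Evaluation.
Context {K : fieldType} {E : s2mod K} {V : lmodType K} (mu : E -> V -> V -> V).
Hypotheses (mu_linear : forall x y, linear (fun e => mu e x y))
  (mu_bilin : forall e, bilin (mu e))
  (mu_act : forall e x y, mu (s2_act e) x y = mu e y x).

Fixpoint tree_eval {X : Type} (rho : X -> V) (t : tree E X) : V :=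
  match t with
  | Leaf x => rho x
  | Node e l r => mu e (tree_eval rho l) (tree_eval rho r)
  end.

Lemma tree_eval_subst {X Y : Type} (rho : Y -> V) (h : X -> tree E Y) t :
  tree_eval rho (subst h t) = tree_eval (tree_eval rho \o h) t.
Proof. by elim: t => //= e l -> r ->. Qed.

Lemma eq_in_tree_eval {X : eqType} (rho rho' : X -> V) (t : tree E X) :
  {in leaves t, rho =1 rho'} -> tree_eval rho t = tree_eval rho' t.
Proof.
elim: t => [x|e l IHl r IHr] /= erho; first by apply: erho; rewrite inE.
by rewrite IHl ?IHr // => x xt; apply: erho; rewrite mem_cat xt ?orbT.
Qed.

Lemma eq_tree_eval {X : Type} (rho rho' : X -> V) :
  rho =1 rho' -> tree_eval rho =1 tree_eval rho'.
Proof. by move=> erho; elim=> //= e l -> r ->. Qed.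

Definition update {X : eqType} (rho : X -> V) (x : X) (v : V) : X -> V :=
  fun x' => if x' == x then v else rho x'.

(** As [x] labels a single leaf, only one branch at each vertex depends on its value, and [mu] is
    linear in that branch. *)
Lemma tree_eval_slot {X : eqType} (rho : X -> V) (x : X) (t : tree E X) :
  count_mem x (leaves t) = 1%N -> linear (fun v => tree_eval (update rho x v) t).
Proof.
have const s v : count_mem x (leaves s) = 0%N ->
    tree_eval (update rho x v) s = tree_eval rho s.
  move=> s0; apply: eq_in_tree_eval => x' x's; rewrite /update; case: eqP => // e.
  by move: s0; rewrite -e => /count_memPn; rewrite x's.
elim: t => [x'|e l IHl r IHr] /=.
  rewrite addn0 /update => ex c u v /=.
  by case: (x' == x) ex.
rewrite count_cat; case el: (count_mem x (leaves l)) => [|[|//]].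
  rewrite add0n => er c u v; rewrite !(const l) // (IHr er).
  exact: (mu_bilin e).2.
rewrite add1n => -[er] c u v; rewrite !(const r) // (IHl el).
exact: (mu_bilin e).1.
Qed.

Definition op_eval {X : finType} (rho : X -> V) : tree_operad K E X -> V :=
  mlift (fun t : ltree E X => tree_eval rho t).

Lemma op_eval_linear {X : finType} (rho : X -> V) : linear (op_eval rho).
Proof. exact: mlift_is_linear. Qed.

Lemma op_evalU {X : finType} (rho : X -> V) (t : ltree E X) :
  op_eval rho << t >> = tree_eval rho t.
Proof. exact: mliftU. Qed.

Lemma op_eval_map {X Y : finType} (f : X -> Y) (Bf : bijective f) (rho : Y -> V) a :
  op_eval rho (op_map (tree_operad K E) Bf a) = op_eval (rho \o f) a.
Proof.
move: a; apply: malg_ext; last 1 first.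
- move=> t; rewrite [op_map _ _ _]tree_mapU !op_evalU /= /relabel.
  by rewrite tree_eval_subst; apply: eq_tree_eval.
- exact: linear_comp (op_eval_linear _) (tree_map_linear Bf).
- exact: op_eval_linear.
Qed.

Lemma op_eval_slot {X : finType} (rho : X -> V) (x : X) a :
  linear (fun v => op_eval (update rho x v) a).
Proof.
apply: mlift_param => t; apply: tree_eval_slot.
by apply/eqP; move/forallP: (valP t); apply.
Qed.

(** Composition becomes substitution: the input [x] of [a] receives the value of [b]. The values of
    [rho \o f] away from [x] are the only ones that count, in accordance with [f x] being
    irrelevant. *)
Lemma op_eval_comp {X Y Z : finType} (x : X) (f : X -> Z) (g : Y -> Z)
    (G : grafting x f g) (rho : Z -> V) a b :
  op_eval rho (op_comp (tree_operad K E) G a b) =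
  op_eval (update (rho \o f) x (op_eval (rho \o g) b)) a.
Proof.
have [Bl Br] := tree_comp_bilin (K := K) (E := E) G.
move: a b; apply: malg_ext2; last 1 first.
- move=> t s; rewrite [op_comp _ _ _ _]tree_compU !op_evalU /= /graft tree_eval_subst.
  apply: eq_tree_eval => x' /=; rewrite /update; case: eqP => // _.
  by rewrite /relabel tree_eval_subst; apply: eq_tree_eval.
- split=> [b|a]; apply: linear_comp (op_eval_linear _) _; [exact: Bl|exact: Br].
- split=> [b|a]; first exact: op_eval_linear.
  exact: (linear_comp (op_eval_slot _ _ _) (op_eval_linear _)).
Qed.

Lemma op_eval_vec {X : finType} (rho : X -> V) (t : tree E X) :
  linear_tree t -> op_eval rho (tree_vec t) = tree_eval rho t.
Proof. by move=> lt; rewrite (tree_vecE lt) op_evalU. Qed.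

(** Induction on the ideal, for all [rho] at once because a composition changes the inputs. When the
    inner operation lies in the ideal, the slot it fills receives 0, and evaluation is linear in
    that slot. *)
Lemma op_eval_ideal (X : finType) a : @op_ideal _ _ (@corolla_rel K E) X a ->
  forall rho : X -> V, op_eval rho a = 0.
Proof.
have l0 (Y : finType) (rho : Y -> V) : op_eval rho 0 = 0.
  exact: (linear_fun0 (op_eval_linear rho)).
elim=> {X a} [X a Sa|X|X c a b _ IHa _ IHb|X Y f Bf a _ IH|X Y Z x f g G a b _ IH
  |X Y Z x f g G a b _ IH] rho //.
- case: Sa rho => [c e e'|e] rho; rewrite (linearBB (op_eval_linear rho)).
    rewrite op_eval_linear /corolla !op_eval_vec /=.
    by apply/eqP; rewrite subr_eq0; apply/eqP; apply: mu_linear.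
    1-3: exact: corolla_lin _ false.
  rewrite /corolla !op_eval_vec /=; first by rewrite mu_act subrr.
    exact: corolla_lin e true.
  exact: corolla_lin _ false.
- by rewrite op_eval_linear IHa IHb scaler0 addr0.
- by rewrite op_eval_map IH.
- by rewrite op_eval_comp IH.
- rewrite op_eval_comp IH; exact: (linear_fun0 (op_eval_slot (rho \o f) x a)).
Qed.

(** Evaluates a chosen representative; [op_eval_ideal] makes the result independent of it. *)
Definition free_eval {X : finType} (rho : X -> V) : free_operad E X -> V :=
  lqlift (op_eval rho).

Lemma free_eval_cls {X : finType} (rho : X -> V) a :
  free_eval rho (qcls (@corolla_rel K E) a) = op_eval rho a.
Proof.
by apply: lqlift_pi; [apply: op_eval_linear | move=> u /op_eval_ideal].
Qed.

Lemma free_eval_linear {X : finType} (rho : X -> V) : linear (free_eval rho).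
Proof.
move=> c u v; have [a ->] := qclsP u; have [b ->] := qclsP v.
by rewrite -qcls_linear !free_eval_cls op_eval_linear.
Qed.

Lemma free_eval_tree {X : finType} (rho : X -> V) (t : tree E X) :
  linear_tree t -> free_eval rho (free_tree t) = tree_eval rho t.
Proof. by move=> lt; rewrite free_eval_cls op_eval_vec. Qed.

Lemma free_eval_map {X Y : finType} (f : X -> Y) (Bf : bijective f) (rho : Y -> V) u :
  free_eval rho (op_map (free_operad E) Bf u) = free_eval (rho \o f) u.
Proof.
have [a ->] := qclsP u.
by rewrite -(hom_map (qcls_hom (@corolla_rel K E))) !free_eval_cls op_eval_map.
Qed.

End Evaluation.

(** * The graded algebra that turns three bilinear forms into a functional on the free operad *)

Section WeightAlgebra.
Context {K : fieldType} {E : s2mod K} (lam : 'I_3 -> E -> E -> K^o).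
Hypothesis lam_bilin : forall k, bilin (lam k).

(* A graded algebra: three variables in degree 1, the E-products of two
   distinct variables in degree 2 (indexed by the missing variable), scalars in degree 3. *)
Definition weight_alg : lmodType K := ({ffun 'I_3 -> K^o} * {ffun 'I_3 -> E} * K^o)%type.

(** In degree 2, the product of the variables [k+1] and [k+2], in this order, is [e] in component
    [k]; the opposite order gives [s2_act e]. In degree 3, component [k] meets only the variable
    [k]: on the right it gives [lam k e], on the left [lam k (s2_act e)]. *)
Definition weight_mul (e : E) (u v : weight_alg) : weight_alg :=
  (0, [ffun k => (u.1.1 (ordS k) * v.1.1 (ordS (ordS k)) : K) *: e
                 + (v.1.1 (ordS k) * u.1.1 (ordS (ordS k)) : K) *: s2_act e],
   \sum_k ((v.1.1 k : K) *: lam k e (u.1.2 k) + (u.1.1 k : K) *: lam k (s2_act e) (v.1.2 k))).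

Lemma weight_alg_eq (u v : weight_alg) :
  u.1.1 = v.1.1 -> u.1.2 =1 v.1.2 -> u.2 = v.2 -> u = v.
Proof. by move: u v => [[a b] c] [[a' b'] c'] /= -> /ffunP -> ->. Qed.

Lemma weight_mul_linear u v : linear (fun e => weight_mul e u v).
Proof.
move=> c e e'; apply: weight_alg_eq => /=.
- by rewrite scaler0 addr0.
- by move=> k; rewrite !ffunE linearP !scalerDr !scalerA ![c * _]mulrC addrACA.
rewrite scaler_sumr -big_split; apply: eq_bigr => k _ /=.
rewrite linearP !(lam_bilin k).1 !scalerDr !scalerA ![c * _]mulrC addrACA //.
Qed.

Lemma weight_mul_act e u v : weight_mul (s2_act e) u v = weight_mul e v u.
Proof.
apply: weight_alg_eq => //=; first by move=> k; rewrite !ffunE s2_actK addrC.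
by apply: eq_bigr => k _; rewrite s2_actK addrC.
Qed.

Lemma weight_mul_bilin e : bilin (weight_mul e).
Proof.
have l e' u : linear (weight_mul e' u).
  move=> c v v'; apply: weight_alg_eq => /=.
  - by rewrite scaler0 addr0.
  - move=> k; rewrite !ffunE mulrDr mulrDl !scalerDl !scalerDr !scalerA addrACA.
    congr (_ *: _ + _ *: _ + _); first exact: mulrCA.
    by rewrite -mulrA.
  rewrite scaler_sumr -big_split; apply: eq_bigr => k _ /=.
  rewrite !ffunE (lam_bilin k).2 scalerDl !scalerDr !scalerA addrACA.
  by rewrite [c * u.1.1 k]mulrC.
(* Exchanging the factors through [s2_act] reduces linearity on the left to linearity on the
   right. *)
split=> // v c u u'; rewrite -!(weight_mul_act e v); exact: l.
Qed.

Definition variable (i : 'I_3) : weight_alg := ([ffun k => (k == i)%:R : K^o], 0, 0).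

(** The degree 3 component is the wanted functional. The map [rho] assigns a variable to each input,
    so that permuting the inputs only changes [rho] ([weight_eval_map]). *)
Definition weight_eval {X : finType} (rho : X -> 'I_3) (a : free_operad E X) : K^o :=
  (free_eval weight_mul (variable \o rho) a).2.

Lemma weight_eval_linear {X : finType} (rho : X -> 'I_3) :
  linear (@weight_eval X rho).
Proof.
move=> c u v; rewrite /weight_eval.
rewrite (free_eval_linear weight_mul_linear weight_mul_bilin weight_mul_act) //.
Qed.

Lemma weight_eval_map {X Y : finType} (f : X -> Y) (Bf : bijective f) (rho : Y -> 'I_3) a :
  weight_eval rho (op_map (free_operad E) Bf a) = weight_eval (rho \o f) a.
Proof.
by rewrite /weight_eval (free_eval_map weight_mul_linear weight_mul_bilin weight_mul_act).
Qed.

Lemma ordS3 (k : 'I_3) : ordS (ordS (ordS k)) = k.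
Proof. by apply: val_inj; move: k => [[|[|[|]]]]. Qed.

Lemma ordS_neq (k : 'I_3) : (ordS k == k) = false.
Proof. by move: k => [[|[|[|]]]]. Qed.

Lemma weight_mul2 e (i j : 'I_3) :
  weight_mul e (variable i) (variable j) =
  (0, [ffun k => ((ordS k == i) && (ordS (ordS k) == j))%:R *: e
                 + ((ordS k == j) && (ordS (ordS k) == i))%:R *: s2_act e], 0).
Proof.
apply: weight_alg_eq => //=.
  by move=> k; rewrite !ffunE -!natrM !mulnb.
rewrite big1 // => k _; rewrite !ffunE.
by rewrite !(linear_fun0 ((lam_bilin k).2 _)) !scaler0 addr0.
Qed.

Lemma weight_eval3 {X : finType} (rho : X -> 'I_3) (i j k : X) e e' :
  three_inputs i j k ->
  weight_eval rho (free_tree (Node e (Node e' (Leaf i) (Leaf j)) (Leaf k))) =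
  lam (rho k) e (((ordS (rho k) == rho i) && (ordS (ordS (rho k)) == rho j))%:R *: e'
           + ((ordS (rho k) == rho j) && (ordS (ordS (rho k)) == rho i))%:R *: s2_act e').
Proof.
move=> ijk; rewrite /weight_eval.
rewrite (free_eval_tree weight_mul_linear weight_mul_bilin weight_mul_act); last first.
  exact: linear_comb3.
rewrite -[tree_eval _ _ _]/(weight_mul e (weight_mul e' (variable (rho i))
  (variable (rho j))) (variable (rho k))).
(* The outer factor is the variable [rho k], hence only the component [rho k] of the inner product
   survives. *)
rewrite weight_mul2 /= (bigD1 (rho k)) //= big1 => [|l nl].
  by rewrite !ffunE eqxx scale1r scale0r !addr0.
by rewrite !ffunE (negPf nl) !scale0r addr0.
Qed.

(** The inner variables are in the cyclic order of [weight2_op], so the form is applied to the two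
    decorations as they stand. *)
Lemma weight_eval_even {X : finType} (rho : X -> 'I_3) (i j k : X) e e' :
  three_inputs i j k -> rho i = ordS (rho k) -> rho j = ordS (ordS (rho k)) ->
  weight_eval rho (free_tree (Node e (Node e' (Leaf i) (Leaf j)) (Leaf k))) = lam (rho k) e e'.
Proof.
move=> ijk ei ej; rewrite weight_eval3 // ei ej !eqxx.
by rewrite [ordS _ == _]eq_sym ordS_neq scale1r scale0r addr0.
Qed.

(** The inner variables are against the cyclic order, which turns the inner decoration by
    [s2_act]. *)
Lemma weight_eval_odd {X : finType} (rho : X -> 'I_3) (i j k : X) e e' :
  three_inputs i j k -> rho i = ordS (ordS (rho k)) -> rho j = ordS (rho k) ->
  weight_eval rho (free_tree (Node e (Node e' (Leaf i) (Leaf j)) (Leaf k))) =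
  lam (rho k) e (s2_act e').
Proof.
move=> ijk ei ej; rewrite weight_eval3 // ei ej !eqxx.
by rewrite [ordS _ == _]eq_sym ordS_neq scale1r scale0r add0r.
Qed.

End WeightAlgebra.

(** * Cyclic bookkeeping on three inputs *)

Section ThreeOrdinals.

Lemma ord3_cases (i j : 'I_3) : [\/ j = i, j = ordS i | j = ordS (ordS i)].
Proof.
by move: i j => [[|[|[|//]]] Hi] [[|[|[|//]]] Hj];
  (constructor 1; exact: val_inj) || (constructor 2; exact: val_inj)
  || (constructor 3; exact: val_inj).
Qed.

Lemma three_inputs_rot (k : 'I_3) : three_inputs (ordS k) (ordS (ordS k)) k.
Proof.
split; first by move: k => [[|[|[|]]]].
by move=> z; have [->|->|->] := ord3_cases k z; rewrite !inE eqxx ?orbT.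
Qed.

Lemma three_inputsC {X : finType} (i j k : X) : three_inputs i j k -> three_inputs j i k.
Proof.
move=> [u m]; split=> [|z]; last by have := m z; rewrite !inE orbCA.
by move: u; rewrite /= !inE !negb_or [j == i]eq_sym => /andP[/andP[-> ->]] /andP[->].
Qed.

Lemma three_inputs_shift {X : finType} (i j k : X) : three_inputs i j k -> three_inputs j k i.
Proof.
move=> [u m]; rewrite /three_inputs -[[:: j; k; i]]/(rot 1 [:: i; j; k]) rot_uniq.
by split=> // z; rewrite mem_rot.
Qed.

(** The two cases are the even and the odd orders of the inputs. *)
Lemma three_inputs_cases (i j k : 'I_3) : three_inputs i j k ->
  (i = ordS k /\ j = ordS (ordS k)) \/ (i = ordS (ordS k) /\ j = ordS k).
Proof.
move=> [/= /andP[]]; rewrite !inE negb_or => /andP[ij ik] /andP[jk _] _.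
move: ij ik jk; have [->|->|->] := ord3_cases k i; have [->|->|->] := ord3_cases k j;
  rewrite ?eqxx // => _ _ _; try (by left); by right.
Qed.

Lemma three_inputs_inj (f : 'I_3 -> 'I_3) : injective f -> three_inputs (f 0) (f 1) (f 2).
Proof.
move=> fI; have [g fK gK] := injF_bij fI; split; first by rewrite /= !inE !(inj_eq fI).
move=> z; rewrite -[z]gK !inE !(inj_eq fI).
by have [->|->|->] := ord3_cases 0 (g z).
Qed.

(** Serves to transport relations, stated on the inputs 0, 1, 2, to any order of the inputs. *)
Lemma three_inputs_perm (i j k : 'I_3) : three_inputs i j k ->
  exists f : 'I_3 -> 'I_3, [/\ bijective f, f 0 = i, f 1 = j & f 2 = k].
Proof.
move=> [u m]; exists (fun l => nth 0 [:: i; j; k] l); split=> //.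
apply: injF_bij => a b /eqP; rewrite (nth_uniq 0 _ _ u) ?ltn_ord //.
by move=> /eqP/val_inj.
Qed.

(** Each family is reindexed by a cyclic shift; the shifts are those by which the permutative
    rewritings move the index in [perm_normalE]. *)
Lemma sum_ordS_shift (V : zmodType) (a b c d : 'I_3 -> V) :
  \sum_k (a k + b k + c k + d k) =
  \sum_k (d k + c (ordS (ordS k)) + a (ordS k) + b (ordS k)).
Proof.
have shift (f : 'I_3 -> V) : \sum_k f (ordS k) = \sum_k f k.
  by rewrite [RHS](reindex_inj (@ordS_inj 3)).
rewrite !big_split /= (shift (fun k => c (ordS k))) !shift.
by rewrite addrC [X in _ + X = _]addrC !addrA.
Qed.

End ThreeOrdinals.

(** * Further rules for tensor products of maps *)

Section TensorTheory.
Context {K : fieldType}.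

Lemma eq_tens_lift {U V W : lmodType K} (f g : U -> V -> W) t :
  (forall u v, f u v = g u v) -> tens_lift f t = tens_lift g t.
Proof. by move=> e; congr (tens_lift _ t); apply/funext => u; apply/funext. Qed.

Lemma linear_add {U V : lmodType K} (f g : U -> V) :
  linear f -> linear g -> linear (fun x => f x + g x).
Proof. by move=> lf lg c x y; rewrite lf lg scalerDr addrACA. Qed.

Lemma linear_tens_lift {U V W W' : lmodType K} (h : W -> W') (f : U -> V -> W) t :
  linear h -> bilin f -> h (tens_lift f t) = tens_lift (fun u v => h (f u v)) t.
Proof.
move=> lh [fl fr].
have Bhf : bilin (fun u v => h (f u v)).
  by split=> [v|u]; apply: linear_comp lh _; [apply: fl | apply: fr].
move: t; apply: tens_ext; [|exact: tens_lift_linear|].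
  exact: linear_comp lh (tens_lift_linear _).
by move=> u v; rewrite !tens_lift_pure.
Qed.

Lemma tens_lift_map {U V U' V' W : lmodType K} (f : U -> U') (g : V -> V')
    (h : U' -> V' -> W) t : linear f -> linear g -> bilin h ->
  tens_lift h (tmap f g t) = tens_lift (fun u v => h (f u) (g v)) t.
Proof.
move=> lf lg [hl hr].
have Bh : bilin (fun u v => h (f u) (g v)).
  by split=> [v|u]; [apply: linear_comp (hl _) lf | apply: linear_comp (hr _) lg].
move: t; apply: tens_ext; [|exact: tens_lift_linear|].
  exact: linear_comp (tens_lift_linear _) (tmap_linear lf lg).
by move=> u v; rewrite tmap_pure // !tens_lift_pure.
Qed.

Lemma tmap_comp {U V U' V' U'' V'' : lmodType K} (f : U -> U') (g : V -> V')
    (f' : U' -> U'') (g' : V' -> V'') t :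
  linear f -> linear g -> linear f' -> linear g' ->
  tmap f' g' (tmap f g t) = tmap (f' \o f) (g' \o g) t.
Proof.
move=> lf lg lf' lg'.
by rewrite [LHS]tens_lift_map // /tmap; [apply: tmap_bilin].
Qed.

Lemma tmap_id {U V : lmodType K} (f : U -> U) (g : V -> V) t :
  f =1 id -> g =1 id -> tmap f g t = t.
Proof.
move=> /funext-> /funext->; move: t; apply: tens_ext.
- exact: tmap_linear (@linear_id _ _) (@linear_id _ _).
- exact: linear_id.
- by move=> u v; rewrite tmap_pure //; apply: linear_id.
Qed.

Lemma pure0l {U V : lmodType K} (v : V) : (0 : U) ⊗ v = 0.
Proof. exact: (linear_fun0 (pure_bilin.1 v)). Qed.

Lemma pure0r {U V : lmodType K} (u : U) : u ⊗ (0 : V) = 0.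
Proof. exact: (linear_fun0 (pure_bilin.2 u)). Qed.

Lemma linear_zero {U V : lmodType K} : linear (fun _ : U => 0 : V).
Proof. by move=> c x y; rewrite scaler0 addr0. Qed.

Lemma tmap0l {U V U' V' : lmodType K} (f : U -> U') (g : V -> V') t :
  linear g -> f =1 (fun=> 0) -> tmap f g t = 0.
Proof.
move=> lg /funext->; move: t; apply: (tens_ext (f2 := fun=> 0)).
- exact: tmap_linear linear_zero lg.
- exact: linear_zero.
- by move=> u v; rewrite tmap_pure ?pure0l //; apply: linear_zero.
Qed.

Lemma tmap0r {U V U' V' : lmodType K} (f : U -> U') (g : V -> V') t :
  linear f -> g =1 (fun=> 0) -> tmap f g t = 0.
Proof.
move=> lf /funext->; move: t; apply: (tens_ext (f2 := fun=> 0)).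
- exact: tmap_linear lf linear_zero.
- exact: linear_zero.
- by move=> u v; rewrite tmap_pure ?pure0r //; apply: linear_zero.
Qed.

Lemma tens_liftD {U V W : lmodType K} (f : U -> V -> W) : bilin f ->
  {morph tens_lift f : s t / s + t}.
Proof. by move=> Bf; apply/linear_funD/tens_lift_linear. Qed.

End TensorTheory.

(** * Weight 2 operations as three copies of the tensor square of the generators *)

Section Weight2.
Context {K : fieldType} {E : s2mod K}.

Lemma weight2_tree_bilin (k : 'I_3) : bilin (fun e e' : E => free_tree
  (Node e (Node e' (Leaf (ordS k)) (Leaf (ordS (ordS k)))) (Leaf k))).
Proof. exact/free_tree3_bilin/three_inputs_rot. Qed.

Lemma weight2_op_linear : linear (@weight2_op K E).
Proof.
move=> c u v; rewrite /weight2_op scaler_sumr -big_split; apply: eq_bigr => k _.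
by rewrite !ffunE (tens_lift_linear (weight2_tree_bilin k)).
Qed.

Definition single (k : 'I_3) (t : (E ⊗ E)%type) : weight2 E :=
  [ffun l => if l == k then t else 0].

Lemma weight2_op_single (k : 'I_3) (t : (E ⊗ E)%type) :
  weight2_op (single k t) = tens_lift (fun e e' : E => free_tree
    (Node e (Node e' (Leaf (ordS k)) (Leaf (ordS (ordS k)))) (Leaf k))) t.
Proof.
rewrite /weight2_op (bigD1 k) //= ffunE eqxx big1 ?addr0 // => l /negPf nl.
by rewrite ffunE nl; apply/linear_fun0/tens_lift_linear/weight2_tree_bilin.
Qed.

Lemma weight2_tree (k : 'I_3) e e' :
  free_tree (Node e (Node e' (Leaf (ordS k)) (Leaf (ordS (ordS k)))) (Leaf k)) =
  weight2_op (single k ((e : E) ⊗ (e' : E))).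
Proof. by rewrite weight2_op_single tens_lift_pure //; apply: weight2_tree_bilin. Qed.

Lemma linear_three_leaves {X : finType} (i j k : X) (t : tree E X) :
  leaves t = [:: i; j; k] -> linear_tree t -> three_inputs i j k.
Proof.
rewrite /linear_tree => -> /forallP lt; split=> [|z].
  apply: count_mem_uniq => z; rewrite (eqP (lt z)) -has_pred1 has_count.
  by rewrite (eqP (lt z)).
by rewrite -has_pred1 has_count (eqP (lt z)).
Qed.

Lemma leaves_pos {X : Type} (t : tree E X) : (0 < size (leaves t))%N.
Proof. by elim: t => //= e l IHl r IHr; rewrite size_cat addn_gt0 IHl. Qed.

Lemma size_leaves1 {X : Type} (t : tree E X) : size (leaves t) = 1%N -> exists x, t = Leaf x.
Proof.
case: t => [x|e l r] /=; first by exists x.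
rewrite size_cat => s1; have := leq_add (leaves_pos l) (leaves_pos r).
by rewrite s1.
Qed.

Lemma size_leaves2 {X : Type} (t : tree E X) : size (leaves t) = 2%N ->
  exists e i j, t = Node e (Leaf i) (Leaf j).
Proof.
case: t => [x|e l r] //=; rewrite size_cat.
have := leaves_pos l; have := leaves_pos r => pr pl s2.
have [i ->] : exists i, l = Leaf i by apply: size_leaves1; lia.
have [j ->] : exists j, r = Leaf j by apply: size_leaves1; lia.
by exists e, i, j.
Qed.

Lemma size_leaves3 {X : Type} (t : tree E X) : size (leaves t) = 3%N ->
  exists e e' i j k, t = Node e (Node e' (Leaf i) (Leaf j)) (Leaf k) \/
                     t = Node e (Leaf k) (Node e' (Leaf i) (Leaf j)).
Proof.
case: t => [x|e l r] //=; rewrite size_cat.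
have := leaves_pos l; have := leaves_pos r => pr pl s3.
have [[El Er]|[El Er]] : (size (leaves l) = 2%N /\ size (leaves r) = 1%N) \/
    (size (leaves l) = 1%N /\ size (leaves r) = 2%N) by lia.
  have [k ->] := size_leaves1 Er; have [e' [i [j ->]]] := size_leaves2 El.
  by exists e, e', i, j, k; left.
have [k ->] := size_leaves1 El; have [e' [i [j ->]]] := size_leaves2 Er.
by exists e, e', i, j, k; right.
Qed.

(** A binary tree with three leaves has one of two shapes. The action at the root turns the
    right-nested shape into the left-nested one, and the action at the inner vertex puts the inner
    leaves in cyclic order. *)
Lemma weight2_op_surj (y : free_operad E 'I_3) : exists u, y = weight2_op u.
Proof.
have [a ->] := qclsP y; rewrite [a]malg_span.
rewrite (linear_fun_sum (qcls_linear (@corolla_rel K E) (X := 'I_3))).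
elim/big_rec: _ => [|t _ _ [u ->]].
  by exists 0; rewrite (linear_fun0 weight2_op_linear).
suff [v ev] : exists v, qcls (@corolla_rel K E) << t >> = weight2_op v.
  exists (a@_t *: v + u); rewrite weight2_op_linear -ev.
  by rewrite (linear_funZ (qcls_linear (@corolla_rel K E) (X := 'I_3))).
have -> : qcls (@corolla_rel K E) << t >> = free_tree t.
  by rewrite /free_tree (tree_vecE (valP t)); congr qcls; congr (<< _ >>); apply: val_inj.
have := valP t; case: t => t /= _ lt.
have rot i j k e e' : three_inputs i j k -> exists v,
    free_tree (Node e (Node e' (Leaf i) (Leaf j)) (Leaf k)) = weight2_op (v : weight2 E).
  move=> ijk; case: (three_inputs_cases ijk) => [[-> ->]|[ei ej]].
    by eexists; apply: weight2_tree.
  rewrite -(free_tree_inner_act (three_inputsC ijk)) ei ej.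
  by eexists; apply: weight2_tree.
have s3 : size (leaves t) = 3%N.
  have /perm_size-> : perm_eq (leaves t) (enum 'I_3); last by rewrite size_enum_ord.
  apply/allP => x _ /=; move/forallP: lt => /(_ x) /eqP ->.
  by rewrite count_uniq_mem ?enum_uniq // mem_enum.
have [e [e' [i [j [k [et|et]]]]]] := size_leaves3 s3; move: lt; rewrite et => lt.
  by apply: rot; apply: linear_three_leaves lt.
have ijk : three_inputs i j k.
  by apply: three_inputs_shift; apply: linear_three_leaves lt.
by rewrite -(free_tree_root_act ijk); apply: rot.
Qed.

End Weight2.

Lemma free_map_weight2 {K : fieldType} {E E' : s2mod K} (phi : E -> E')
    (lphi : linear phi) (phi_act : forall e, phi (s2_act e) = s2_act (phi e)) (w : weight2 E) :
  free_map phi (weight2_op w) = weight2_op [ffun k => tmap phi phi (w k)].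
Proof.
have lF := hom_linear (free_map_hom lphi phi_act) (X := 'I_3).
rewrite /weight2_op (linear_fun_sum lF); apply: eq_bigr => k _.
rewrite ffunE (tens_lift_map _ lphi lphi (weight2_tree_bilin k)).
rewrite (linear_tens_lift _ lF (weight2_tree_bilin k)).
by apply: eq_tens_lift => e e'; apply: free_map_tree.
Qed.

(** * Normal form of weight 2 operations modulo the permutative relations *)

Section PermNormalForm.
Context {K : fieldType} {B : vectType K} (Psi : dual_lCEDS B).
Implicit Types (a b c d : B) (k : 'I_3).

(** [plain b] is the product of index [b], and [reversed b] the same product with its arguments
    exchanged; [s2_act] swaps the two. *)
Definition plain b : free_s2 B := (b, 0).
Definition reversed b : free_s2 B := (0, b).

Lemma plain_linear : linear plain.
Proof. by move=> c x y; congr pair => /=; rewrite scaler0 addr0. Qed.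

Lemma reversed_linear : linear reversed.
Proof. by move=> c x y; congr pair => /=; rewrite scaler0 addr0. Qed.

(* Modulo the permutative relations, every weight 2 operation is a sum over k of
   operations with both vertices reversed; this is its k-th component. *)
Definition perm_normal (w : weight2 (free_s2 B)) k : (B ⊗ B)%type :=
  tmap snd snd (w k) + tflip (tmap snd fst (w (ordS (ordS k))))
  + tflip (Psi (tmap fst fst (w (ordS k)))) + Psi (tmap fst snd (w (ordS k))).

Local Notation P := (quad_operad (Perm Psi)).

Definition perm_cls (y : free_operad (free_s2 B) 'I_3) : P 'I_3 :=
  qcls (@quad_ideal_gen K (Perm Psi)) y.

Lemma perm_cls_linear : linear perm_cls.
Proof. exact: qcls_linear. Qed.

Lemma prod_bilinl {X : finType} (i j k : X) : three_inputs i j k ->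
  bilin (fun c d => free_tree (prod_op c (prod_op d (Leaf i) (Leaf j)) (Leaf k))).
Proof.
move=> ijk; have [Bl Br] := free_tree3_bilin (E := free_s2 B) ijk.
split=> [d|c].
  exact: linear_comp (Bl (plain d)) plain_linear.
exact: linear_comp (Br (plain c)) plain_linear.
Qed.

(** A product whose right factor is composite is a reversed product whose left factor is composite,
    which is the shape used by [weight2_op]. *)
Lemma free_prod_act {X : finType} (i j k : X) e c : three_inputs i j k ->
  free_tree (prod_op c (Leaf k) (Node (e : free_s2 B) (Leaf i) (Leaf j))) =
  free_tree (Node (reversed c) (Node e (Leaf i) (Leaf j)) (Leaf k)).
Proof. by move=> ijk; rewrite -(free_tree_root_act ijk). Qed.

Lemma prod_bilinr {X : finType} (i j k : X) : three_inputs i j k ->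
  bilin (fun c d => free_tree (prod_op c (Leaf k) (prod_op d (Leaf i) (Leaf j)))).
Proof.
move=> ijk; have [Bl Br] := free_tree3_bilin (E := free_s2 B) ijk.
split=> [d|c].
  move=> x u v; rewrite !(free_prod_act _ _ ijk).
  exact: (linear_comp (Bl (plain d)) reversed_linear).
move=> x u v; rewrite !(free_prod_act _ _ ijk).
exact: (linear_comp (Br (reversed c)) plain_linear).
Qed.

Lemma three_inputs012 : three_inputs (0 : 'I_3) 1 2.
Proof. exact: (three_inputs_inj (f := id)). Qed.

Lemma perm_rel_map (f : 'I_3 -> 'I_3) (Bf : bijective f) r :
  perm_rel Psi r -> perm_cls (op_map _ Bf r) = 0.
Proof. by move=> Rr; apply/qcls_eq0/ideal_map/ideal_gen/Quad_ideal_gen. Qed.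

Lemma perm_comm (i j k : 'I_3) a b : three_inputs i j k ->
  perm_cls (free_tree (prod_op a (Leaf i) (prod_op b (Leaf j) (Leaf k)))) =
  perm_cls (free_tree (prod_op b (Leaf j) (prod_op a (Leaf i) (Leaf k)))).
Proof.
move=> /three_inputs_perm[f [Bf <- <- <-]].
have := perm_rel_map Bf (Perm_rel_comm Psi a b).
have [c012 c120] := (three_inputs012, three_inputs_shift three_inputs012).
have c021 := three_inputs_shift (three_inputsC c012).
rewrite (linearBB (op_map_linear _ Bf)) !free_tree_map; try exact: linear_comb3r.
by rewrite (linearBB perm_cls_linear) => /eqP; rewrite subr_eq0 => /eqP.
Qed.

Lemma perm_assoc (i j k : 'I_3) a b : three_inputs i j k ->
  perm_cls (free_tree (prod_op a (prod_op b (Leaf i) (Leaf j)) (Leaf k))) =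
  tens_lift (fun c d => perm_cls (free_tree (prod_op c (Leaf i) (prod_op d (Leaf j) (Leaf k)))))
    (Psi (a ⊗ b)).
Proof.
move=> /three_inputs_perm[f [Bf <- <- <-]].
have := perm_rel_map Bf (Perm_rel_assoc Psi a b).
have [c012 c120] := (three_inputs012, three_inputs_shift three_inputs012).
rewrite (linearBB (op_map_linear _ Bf)) (linear_tens_lift _ (op_map_linear _ Bf)); last first.
  exact: prod_bilinr.
rewrite (linearBB perm_cls_linear) (linear_tens_lift _ perm_cls_linear) => [/eqP|]; last first.
  have [Bl Br] := prod_bilinr c120.
  by split=> [d|c]; apply: linear_comp (op_map_linear _ Bf) _.
rewrite subr_eq0 => /eqP; rewrite free_tree_map; last exact: linear_comb3.
move=> ->; apply: eq_tens_lift => c d.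
by rewrite free_tree_map //; apply: linear_comb3r.
Qed.

Definition perm_node k (e e' : free_s2 B) : P 'I_3 :=
  perm_cls (free_tree (Node e (Node e' (Leaf (ordS k)) (Leaf (ordS (ordS k)))) (Leaf k))).

Lemma perm_node_bilin k (f g : B -> free_s2 B) : linear f -> linear g ->
  bilin (fun c d => perm_node k (f c) (g d)).
Proof.
move=> lf lg; have [Bl Br] := weight2_tree_bilin (E := free_s2 B) k.
split=> [d|c]; apply: linear_comp perm_cls_linear _.
  exact: linear_comp (Bl _) lf.
exact: linear_comp (Br _) lg.
Qed.

Let rot k := three_inputs_rot k.

(** Associativity turns [(x_(k+1) x_(k+2)) x_k] into [x_(k+1) (x_(k+2) x_k)], a tree of index [k+1]
    with reversed root. *)
Lemma perm_node_plain_plain k t :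
  tens_lift (fun c d => perm_node k (plain c) (plain d)) t =
  tens_lift (fun c d => perm_node (ordS k) (reversed c) (plain d)) (Psi t).
Proof.
move: t; apply: tens_ext.
- exact/tens_lift_linear/perm_node_bilin/plain_linear/plain_linear.
- apply: linear_comp (tens_lift_linear _) (linearP _).
  exact: perm_node_bilin reversed_linear plain_linear.
move=> c d; rewrite tens_lift_pure; last exact: perm_node_bilin plain_linear plain_linear.
rewrite [LHS](perm_assoc c d (rot k)); apply: eq_tens_lift => c' d'; rewrite /perm_node.
rewrite free_prod_act ?ordS3 //.
by have := rot (ordS k); rewrite ordS3.
Qed.

(** Associativity turns [(x_(k+2) x_(k+1)) x_k] into [x_(k+2) (x_(k+1) x_k)], a tree of index [k+2]
    with both vertices reversed. *)
Lemma perm_node_plain_reversed k t :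
  tens_lift (fun c d => perm_node k (plain c) (reversed d)) t =
  tens_lift (fun c d => perm_node (ordS (ordS k)) (reversed c) (reversed d)) (Psi t).
Proof.
move: t; apply: tens_ext.
- exact: tens_lift_linear (perm_node_bilin _ plain_linear reversed_linear).
- apply: linear_comp (tens_lift_linear _) (linearP _).
  exact: perm_node_bilin reversed_linear reversed_linear.
move=> c d; rewrite tens_lift_pure; last exact: perm_node_bilin plain_linear reversed_linear.
have rk := three_inputsC (rot k).
rewrite /perm_node -[reversed d]/(s2_act (plain d)) (free_tree_inner_act (rot k)).
rewrite [LHS](perm_assoc c d rk); apply: eq_tens_lift => c' d'.
rewrite ordS3 -[reversed d']/(s2_act (plain d')) (free_tree_inner_act (three_inputsC _)).
  by rewrite free_prod_act //; apply: three_inputs_shift.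
exact: three_inputs_shift.
Qed.

(** The commutation relation turns [x_k (x_(k+1) x_(k+2))] into [x_(k+1) (x_k x_(k+2))]. The two
    indices change places, whence the flip. *)
Lemma perm_node_reversed_plain k t :
  tens_lift (fun c d => perm_node k (reversed c) (plain d)) t =
  tens_lift (fun c d => perm_node (ordS k) (reversed c) (reversed d)) (tflip t).
Proof.
move: t; apply: tens_ext.
- exact: tens_lift_linear (perm_node_bilin _ reversed_linear plain_linear).
- apply: linear_comp (tens_lift_linear _) tflip_linear.
  exact: perm_node_bilin reversed_linear reversed_linear.
move=> c d; rewrite tflip_pure !tens_lift_pure;
  try by apply: perm_node_bilin;
    [exact: reversed_linear | (exact: plain_linear) || (exact: reversed_linear)].
rewrite /perm_node ordS3 -(free_prod_act _ _ (rot k)) [LHS]perm_comm; last first.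
  by apply: three_inputs_shift; apply: three_inputs_shift; apply: rot.
rewrite -[reversed c]/(s2_act (plain c)) free_tree_inner_act; last first.
  exact: three_inputs_shift.
by rewrite free_prod_act //; apply/three_inputsC/three_inputs_shift.
Qed.

Lemma perm_node_split k t :
  tens_lift (perm_node k) t =
  tens_lift (fun c d => perm_node k (plain c) (plain d)) (tmap fst fst t)
  + tens_lift (fun c d => perm_node k (plain c) (reversed d)) (tmap fst snd t)
  + tens_lift (fun c d => perm_node k (reversed c) (plain d)) (tmap snd fst t)
  + tens_lift (fun c d => perm_node k (reversed c) (reversed d)) (tmap snd snd t).
Proof.
have l1 : linear (fst : free_s2 B -> B) by [].
have l2 : linear (snd : free_s2 B -> B) by [].
have Bn : bilin (perm_node k).
  have [Bl Br] := weight2_tree_bilin (E := free_s2 B) k.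
  by split=> [e|e]; apply: linear_comp perm_cls_linear _; [apply: Bl | apply: Br].
have [Bl Br] := Bn.
have pl := plain_linear; have ol := reversed_linear.
have lD f g : bilin f -> linear g -> linear (fun t => tens_lift f (g t)) :=
  fun Bf lg => linear_comp (tens_lift_linear Bf) lg.
move: t; apply: tens_ext; first exact: tens_lift_linear.
  do 3 ?apply: linear_add; apply: lD; try exact: tmap_linear; exact: perm_node_bilin.
move=> e e'; rewrite !tmap_pure // !tens_lift_pure; try (exact: perm_node_bilin || exact: Bn).
have split_pair (x : free_s2 B) : x = plain x.1 + reversed x.2.
  by case: x => a b; congr pair; rewrite /= ?addr0 ?add0r.
rewrite [in LHS](split_pair e) [in LHS](split_pair e').
rewrite (linear_funD (Bl _)) !(linear_funD (Br _)).
by rewrite !addrA.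
Qed.

(** Each vertex splits into a plain and a reversed part, and the three rewritings above apply. The
    plain-plain part needs two of them, which gives the term with both [tflip] and [Psi]. *)
Lemma perm_normalE (w : weight2 (free_s2 B)) :
  perm_cls (weight2_op w) =
  \sum_k tens_lift (fun c d => perm_node k (reversed c) (reversed d)) (perm_normal w k).
Proof.
have Bo k := perm_node_bilin k reversed_linear reversed_linear.
rewrite (linear_fun_sum perm_cls_linear).
under eq_bigr => k _ do rewrite (linear_tens_lift _ perm_cls_linear (weight2_tree_bilin k))
  perm_node_split perm_node_plain_plain perm_node_plain_reversed
  perm_node_reversed_plain perm_node_reversed_plain.
under [RHS]eq_bigr => k _ do rewrite !(tens_liftD (Bo k)).
rewrite [LHS]sum_ordS_shift; apply: eq_bigr => k _.
by rewrite !ordS3.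
Qed.

Lemma perm_normal_linear k : linear (perm_normal^~ k).
Proof.
have l1 : linear (fst : free_s2 B -> B) by [].
have l2 : linear (snd : free_s2 B -> B) by [].
have lw l : linear (fun w : weight2 (free_s2 B) => w l) by move=> c u v; rewrite !ffunE.
have lP : linear Psi := linearP _.
do 3 ?apply: linear_add.
- exact: linear_comp (tmap_linear l2 l2) (lw _).
- exact: linear_comp tflip_linear (linear_comp (tmap_linear l2 l1) (lw _)).
- exact: linear_comp tflip_linear (linear_comp lP (linear_comp (tmap_linear l1 l1) (lw _))).
- exact: linear_comp lP (linear_comp (tmap_linear l1 l2) (lw _)).
Qed.

Lemma perm_normal_single l t k : perm_normal (single l t) k =
  (if k == l then tmap snd snd t else 0)
  + (if k == ordS l then tflip (tmap snd fst t) else 0)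
  + (if k == ordS (ordS l) then tflip (Psi (tmap fst fst t)) + Psi (tmap fst snd t) else 0).
Proof.
have l1 : linear (fst : free_s2 B -> B) by [].
have l2 : linear (snd : free_s2 B -> B) by [].
have lF : linear (@tflip K B B) := tflip_linear.
have eS m : (ordS (ordS k) == m) = (k == ordS m) by rewrite -(inj_eq (@ordS_inj 3)) ordS3.
have eSS m : (ordS k == m) = (k == ordS (ordS m)).
  by rewrite -(inj_eq (@ordS_inj 3)) eS.
rewrite /perm_normal !ffunE eS eSS -!addrA.
congr (_ + (_ + _)).
- by case: eqP => // _; rewrite (linear_fun0 (tmap_linear l2 l2)).
- by case: eqP => // _; rewrite (linear_fun0 (tmap_linear l2 l1)) (linear_fun0 lF).
- case: eqP => // _; rewrite (linear_fun0 (tmap_linear l1 l1)) (linear_fun0 (tmap_linear l1 l2)).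
  by rewrite [Psi 0]linear0 (linear_fun0 lF) addr0.
Qed.

Lemma perm_normal_pure l (p p' : free_s2 B) k : perm_normal (single l (p ⊗ p')) k =
  (if k == l then p.2 ⊗ p'.2 else 0) + (if k == ordS l then p'.1 ⊗ p.2 else 0)
  + (if k == ordS (ordS l) then tflip (Psi (p.1 ⊗ p'.1)) + Psi (p.1 ⊗ p'.2) else 0).
Proof. by rewrite perm_normal_single !tmap_pure // tflip_pure. Qed.

(** Stated for an arbitrary tensor because it is applied to [Psi (a ⊗ b)], which need not be
    pure. *)
Lemma perm_normal_reversed_plain l t k :
  perm_normal (single l (tmap reversed plain t)) k = if k == ordS l then tflip t else 0.
Proof.
have l1 : linear (fst : free_s2 B -> B) by [].
have l2 : linear (snd : free_s2 B -> B) by [].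
have [rl pl] := (reversed_linear, plain_linear).
have z1 : fst \o reversed =1 (fun=> 0) by [].
have z2 : snd \o plain =1 (fun=> 0) by [].
have l1p : linear (fst \o plain : B -> B) := linear_comp l1 pl.
have l2p : linear (snd \o plain : B -> B) := linear_comp l2 pl.
have l2r : linear (snd \o reversed : B -> B) := linear_comp l2 rl.
rewrite perm_normal_single.
have -> : tmap snd snd (tmap reversed plain t) = 0.
  by rewrite (tmap_comp _ rl pl l2 l2) (tmap0r _ l2r z2).
have -> : tmap snd fst (tmap reversed plain t) = t.
  by rewrite (tmap_comp _ rl pl l2 l1) tmap_id.
have -> : tmap fst fst (tmap reversed plain t) = 0.
  by rewrite (tmap_comp _ rl pl l1 l1) (tmap0l _ l1p z1).
have -> : tmap fst snd (tmap reversed plain t) = 0.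
  by rewrite (tmap_comp _ rl pl l1 l2) (tmap0l _ l2p z1).
by rewrite [Psi 0]linear0 (linear_fun0 tflip_linear) addr0 !if_same addr0 add0r.
Qed.

(** Complements [perm_normalE]: the relations used for rewriting have themselves a representative
    with zero normal form. *)
Lemma perm_rel_weight2 r : perm_rel Psi r ->
  exists2 w, r = weight2_op w & forall k, perm_normal w k = 0.
Proof.
have [s0 s1 s2] : [/\ ordS (0 : 'I_3) = 1, ordS (1 : 'I_3) = 2 & ordS (2 : 'I_3) = 0].
  by split; apply: val_inj.
have lF : linear (@tflip K B B) := tflip_linear.
have [pl rl c012] := And3 plain_linear reversed_linear three_inputs012.
have c120 := three_inputs_shift c012.
have B0 := free_tree3_bilin (E := free_s2 B) c012.
have B1 := free_tree3_bilin (E := free_s2 B) c120.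
have B2 := free_tree3_bilin (E := free_s2 B) (three_inputs_shift c120).
case=> [a b|a b].
  (* [(x_0 x_1) x_2] lies in copy 2; [x_0 (x_1 x_2)] lies in copy 0, with reversed root. *)
  exists (single 2 (plain a ⊗ plain b) - single 0 (tmap reversed plain (Psi (a ⊗ b)))).
    rewrite (linearBB weight2_op_linear) !weight2_op_single s2 s0 s1.
    rewrite (tens_lift_pure B0) (tens_lift_map _ rl pl B1).
    by congr (_ - _); apply: eq_tens_lift => c d; rewrite free_prod_act.
  move=> k; rewrite (linearBB (perm_normal_linear k)); apply/eqP; rewrite subr_eq0; apply/eqP.
  apply: etrans (perm_normal_pure _ _ _ _) _; rewrite s2 s0 pure0l pure0r pure0r.
  by rewrite [Psi 0]linear0 !addr0 !if_same !add0r perm_normal_reversed_plain s0.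
(* In [x_1 (x_0 x_2)], of copy 1, the inner leaves are against the cyclic order, so the inner vertex
   is reversed as well. *)
exists (single 0 (reversed a ⊗ plain b) - single 1 (reversed b ⊗ reversed a)).
  rewrite (linearBB weight2_op_linear); apply: (f_equal2 (fun u v => u - v)).
    apply: esym; apply: etrans (weight2_op_single _ _) _; rewrite s0 s1.
    by rewrite (tens_lift_pure B1) free_prod_act.
  apply: esym; apply: etrans (weight2_op_single _ _) _; rewrite s1 s2.
  rewrite (tens_lift_pure B2) free_prod_act; last exact/three_inputsC/three_inputs_shift.
  by rewrite -(free_tree_inner_act (three_inputs_shift c120)).
move=> k; rewrite (linearBB (perm_normal_linear k)); apply/eqP; rewrite subr_eq0; apply/eqP.
apply: etrans (perm_normal_pure _ _ _ _) _; apply: esym.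
apply: etrans (perm_normal_pure _ _ _ _) _; rewrite s0.
by rewrite !pure0l !pure0r [Psi 0]linear0 (linear_fun0 lF) !addr0 !if_same !addr0 add0r.
Qed.

End PermNormalForm.

(** Version of [tmap_adj] for maps between different spaces. *)
Lemma tpairing_tmap {K : fieldType} {U' U V' V U1' U1 V1' V1 : lmodType K}
    (p : U' -> U -> K^o) (q : V' -> V -> K^o) (p1 : U1' -> U1 -> K^o) (q1 : V1' -> V1 -> K^o)
    (f : U' -> U1') (g : V' -> V1') (f' : U1 -> U) (g' : V1 -> V) w t :
  bilin p -> bilin q -> bilin p1 -> bilin q1 ->
  linear f -> linear g -> linear f' -> linear g' ->
  (forall x y, p1 (f x) y = p x (f' y)) -> (forall x y, q1 (g x) y = q x (g' y)) ->
  tpairing p1 q1 (tmap f g w) t = tpairing p q w (tmap f' g' t).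
Proof.
move=> Bp Bq Bp1 Bq1 lf lg lf' lg' ef eg.
have [Bl Bt] := tpairing_bilin Bp Bq; have [Bl1 Bt1] := tpairing_bilin Bp1 Bq1.
move: w; apply: tens_ext; [|exact: Bl|move=> u' v'].
  exact: linear_comp (Bl1 t) (tmap_linear lf lg).
move: t; apply: tens_ext; [exact: Bt1| |move=> u v].
  exact: linear_comp (Bt _) (tmap_linear lf' lg').
by rewrite !tmap_pure // !tpairing_pure // ef eg.
Qed.

(** * The orthogonal of the prelie relations *)

Section PreLieOrthogonal.
Context {K : fieldType} {A : vectType K} (Phi : lCEDS A).
Local Notation B := (dualsp A).
Local Notation P2 := (tpairing (@ev K A) (@ev K A)).
Implicit Types (a b c d : A) (k : 'I_3).

(* The sign makes this map S_2-equivariant, since the action on sgn_dual is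
   twisted by the sign. *)
Definition to_sgn_dual (p : free_s2 B) : sgn_dual (free_s2 A) :=
  linfun (fun u : (A * A)%type => p.1 u.1 - p.2 u.2 : K^o).

Let ev_linear (V : vectType K) (h : dualsp V) : linear h.
Proof. by move=> c x y; rewrite linearP. Qed.

Lemma to_sgn_dualE (p : free_s2 B) (u : (A * A)%type) : to_sgn_dual p u = p.1 u.1 - p.2 u.2.
Proof.
have L : linear (fun u : (A * A)%type => p.1 u.1 - p.2 u.2 : K^o).
  by move=> c x y; rewrite /= !ev_linear opprD addrACA -scalerBr.
pose M := GRing.isLinear.Build K _ _ _ _ L.
pose F : {linear (A * A)%type -> K^o} := HB.pack (fun u : (A * A)%type => p.1 u.1 - p.2 u.2 : K^o) M.
by rewrite /to_sgn_dual (lfunE F).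
Qed.

Lemma to_sgn_dual_linear : linear to_sgn_dual.
Proof.
move=> c p p'; apply/lfunP => u; rewrite add_lfunE scale_lfunE !to_sgn_dualE /=.
by rewrite !add_lfunE !scale_lfunE opprD addrACA scalerBr.
Qed.

Lemma to_sgn_dual_act p : to_sgn_dual (s2_act p) = s2_act (to_sgn_dual p).
Proof.
apply/lfunP => u; rewrite [RHS]sgn_dual_actE !to_sgn_dualE /=.
by rewrite opprB.
Qed.

Definition of_sgn_dual (h : sgn_dual (free_s2 A)) : free_s2 B :=
  (linfun (fun a => h (a, 0)) , linfun (fun a => - h (0, a) : K^o)).

Lemma of_sgn_dualE1 h a : (of_sgn_dual h).1 a = h (a, 0).
Proof.
have L : linear (fun a => h (a, 0) : K^o).
  by move=> c x y; rewrite -linearP; congr (h _); congr pair; rewrite /= scaler0 addr0.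
pose M := GRing.isLinear.Build K _ _ _ _ L.
pose F : {linear A -> K^o} := HB.pack (fun a => h (a, 0) : K^o) M.
by rewrite /= (lfunE F).
Qed.

Lemma of_sgn_dualE2 h a : (of_sgn_dual h).2 a = - h (0, a).
Proof.
have L : linear (fun a => - h (0, a) : K^o).
  move=> c x y; rewrite scalerN -opprD -linearP; congr (- h _); congr pair.
  by rewrite /= scaler0 addr0.
pose M := GRing.isLinear.Build K _ _ _ _ L.
pose F : {linear A -> K^o} := HB.pack (fun a => - h (0, a) : K^o) M.
by rewrite /= (lfunE F).
Qed.

Lemma to_sgn_dualK : cancel to_sgn_dual of_sgn_dual.
Proof.
move=> [f g]; congr pair; apply/lfunP => a.
  by rewrite [LHS]of_sgn_dualE1 to_sgn_dualE /= linear0 subr0.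
by rewrite [LHS]of_sgn_dualE2 to_sgn_dualE /= linear0 sub0r opprK.
Qed.

Lemma of_sgn_dualK : cancel of_sgn_dual to_sgn_dual.
Proof.
move=> h; apply/lfunP => -[a b]; rewrite to_sgn_dualE of_sgn_dualE1 of_sgn_dualE2 opprK.
by rewrite -linearD; congr (h _); congr pair; rewrite /= ?addr0 ?add0r.
Qed.

Lemma of_sgn_dual_linear : linear of_sgn_dual.
Proof.
move=> c h h'; rewrite -{1}[h]of_sgn_dualK -{1}[h']of_sgn_dualK.
by rewrite -to_sgn_dual_linear to_sgn_dualK.
Qed.

Lemma of_sgn_dual_act h : of_sgn_dual (s2_act h) = s2_act (of_sgn_dual h).
Proof. by rewrite -{1}[h]of_sgn_dualK -to_sgn_dual_act to_sgn_dualK. Qed.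

Definition sgn_ev (p : free_s2 B) (e : free_s2 A) : K^o := ev (to_sgn_dual p) e.

Lemma sgn_ev_bilin : bilin sgn_ev.
Proof.
split=> [e|p]; last exact: ev_linear.
exact: linear_comp (ev_bilin.1 _) to_sgn_dual_linear.
Qed.

Let B2 := tpairing_bilin (@ev_bilin K A) (@ev_bilin K A).
Let S2 := tpairing_bilin sgn_ev_bilin sgn_ev_bilin.

(** The tensor [w k] read as a bilinear form on the generators of the prelie operad; these are the
    forms given to the weight algebra. *)
Definition weight_form (w : weight2 (free_s2 B)) k (e e' : free_s2 A) : K^o :=
  tpairing sgn_ev sgn_ev (w k) (e ⊗ e').

Lemma weight_form_bilin w k : bilin (weight_form w k).
Proof.
split=> [e'|e]; apply: linear_comp (S2.2 _) _; [exact: pure_bilin.1|exact: pure_bilin.2].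
Qed.

Lemma weight2_pairingE w u :
  weight2_pairing [ffun k => tmap to_sgn_dual to_sgn_dual (w k)] u =
  \sum_k tpairing sgn_ev sgn_ev (w k) (u k).
Proof.
have Be : bilin (@ev K (A * A)%type) := ev_bilin.
have [L Sb] := (to_sgn_dual_linear, sgn_ev_bilin).
have lid : linear (id : (A * A)%type -> free_s2 A) by [].
apply: eq_bigr => k _; rewrite ffunE.
rewrite (tpairing_tmap _ _ Sb Sb Be Be L L lid lid) //.
by rewrite tmap_id.
Qed.

(** All trees in [weight2_op u] have their leaves in cyclic order, so only the even case of
    evaluation occurs. As the left side is defined on the free operad, the pairing depends on [u]
    only through [weight2_op u]. *)
Lemma weight_eval_op w u : weight_eval (weight_form w) id (weight2_op u) =
  weight2_pairing [ffun k => tmap to_sgn_dual to_sgn_dual (w k)] u.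
Proof.
rewrite weight2_pairingE (linear_fun_sum (weight_eval_linear (weight_form_bilin w) id)).
apply: eq_bigr => k _.
rewrite (linear_tens_lift _ (weight_eval_linear (weight_form_bilin w) id) (weight2_tree_bilin k)).
have E e e' := weight_eval_even (weight_form_bilin w) e e' (three_inputs_rot k)
  (erefl : id (ordS k) = _) (erefl _).
rewrite (eq_tens_lift _ E); move: (u k); apply: tens_ext.
- exact: tens_lift_linear (weight_form_bilin w k).
- exact: S2.2.
by move=> e e'; rewrite (tens_lift_pure (weight_form_bilin w k)).
Qed.

Let l1 : linear (fst : free_s2 B -> B). Proof. by []. Qed.
Let l2 : linear (snd : free_s2 B -> B). Proof. by []. Qed.

(** Absorbs the sign in [to_sgn_dual]: this is the adjoint of the second projection for [sgn_ev]. *)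
Definition neg_reversed a : free_s2 A := - reversed a.

Let lN : linear neg_reversed.
Proof. by move=> c x y; rewrite /neg_reversed reversed_linear opprD scalerN. Qed.

Let ev1 (p : free_s2 B) a : ev p.1 a = sgn_ev p (plain a).
Proof. by rewrite /sgn_ev /ev to_sgn_dualE /= linear0 subr0. Qed.

Let ev2 (p : free_s2 B) a : ev p.2 a = sgn_ev p (neg_reversed a).
Proof. by rewrite /sgn_ev /ev to_sgn_dualE /= oppr0 !linear0 sub0r linearN opprK. Qed.

Section Components.
Context (w : weight2 (free_s2 B)) k (c d : A).
Let Bw := weight_form_bilin w k.
Let Be : bilin (@ev K A) := ev_bilin.
Let Sb := sgn_ev_bilin.
Let pl : linear (@plain K A) := @plain_linear K A.

Lemma weight_form_plain_plain :
  weight_form w k (plain c) (plain d) = P2 (tmap fst fst (w k)) (c ⊗ d).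
Proof.
rewrite (tpairing_tmap _ _ Sb Sb Be Be l1 l1 pl pl ev1 ev1) (tmap_pure pl pl) //.
Qed.

Lemma weight_form_plain_reversed :
  weight_form w k (plain c) (reversed d) = - P2 (tmap fst snd (w k)) (c ⊗ d).
Proof.
rewrite (tpairing_tmap _ _ Sb Sb Be Be l1 l2 pl lN ev1 ev2) (tmap_pure pl lN).
by rewrite -[RHS](linear_funN (Bw.2 _)) opprK.
Qed.

Lemma weight_form_reversed_plain :
  weight_form w k (reversed c) (plain d) = - P2 (tmap snd fst (w k)) (c ⊗ d).
Proof.
rewrite (tpairing_tmap _ _ Sb Sb Be Be l2 l1 lN pl ev2 ev1) (tmap_pure lN pl).
by rewrite -[RHS](linear_funN (Bw.1 _)) opprK.
Qed.

Lemma weight_form_reversed_reversed :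
  weight_form w k (reversed c) (reversed d) = P2 (tmap snd snd (w k)) (c ⊗ d).
Proof.
rewrite (tpairing_tmap _ _ Sb Sb Be Be l2 l2 lN lN ev2 ev2) (tmap_pure lN lN).
rewrite -[RHS]/(weight_form w k (- reversed c) (- reversed d)).
by rewrite (linear_funN (Bw.1 _)) (linear_funN (Bw.2 _)) opprK.
Qed.

End Components.
Definition prelie_elt a b : free_operad (free_s2 A) 'I_3 :=
  (free_tree (prod_op a (Leaf 0) (prod_op b (Leaf 1) (Leaf 2)))
   - tens_lift (fun c d => free_tree (prod_op c (prod_op d (Leaf 0) (Leaf 1)) (Leaf 2)))
       (Phi (a ⊗ b)))
  - (free_tree (prod_op b (Leaf 1) (prod_op a (Leaf 0) (Leaf 2)))
     - tens_lift (fun c d => free_tree (prod_op c (prod_op d (Leaf 1) (Leaf 0)) (Leaf 2)))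
         (Phi (b ⊗ a))).

(** The flip is its own adjoint and [transpose Phi] is the adjoint of [Phi], so both move to the
    argument. *)
Lemma perm_normal_pairing w k c d :
  P2 (perm_normal (transpose Phi) w k) (c ⊗ d) =
  P2 (tmap snd snd (w k)) (c ⊗ d) + P2 (tmap snd fst (w (ordS (ordS k)))) (d ⊗ c)
  + P2 (tmap fst fst (w (ordS k))) (Phi (d ⊗ c)) + P2 (tmap fst snd (w (ordS k))) (Phi (c ⊗ d)).
Proof.
have lPhi : linear Phi := linearP _.
have TE x t : P2 (transpose Phi x) t = P2 x (Phi t) by apply: transposeE.
have FE (x : (B ⊗ B)%type) : P2 (tflip x) (c ⊗ d) = P2 x (d ⊗ c).
  by rewrite (tflip_adj (@ev_bilin K A)) tflip_pure.
have D x y t : P2 (x + y) t = P2 x t + P2 y t := linear_funD (B2.1 t) x y.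
apply: etrans (D _ _ _) _; congr (_ + _); last exact: TE.
apply: etrans (D _ _ _) _; congr (_ + _); last by apply: etrans (FE _) _; apply: TE.
by apply: etrans (D _ _ _) _; rewrite FE.
Qed.

(** * Values of the functional of [w] on the translated prelie relations *)

Section PreLieEval.
Context (w : weight2 (free_s2 B)) (rho : 'I_3 -> 'I_3).
Let eval := weight_eval (weight_form w) rho.
Let leval : linear eval := weight_eval_linear (weight_form_bilin w) rho.
Let Bw := weight_form_bilin w.

Section Inputs.
Context (i j k : 'I_3).
Hypothesis ijk : three_inputs i j k.

(** In this lemma and the next three, the shape decides whether the root is reversed and the parity
    whether the inner vertex is. Each reversed vertex contributes a sign. *)
Lemma eval_left_even t : rho i = ordS (rho k) -> rho j = ordS (ordS (rho k)) ->
  eval (tens_lift (fun c d => free_tree (prod_op c (prod_op d (Leaf i) (Leaf j)) (Leaf k))) t) =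
  P2 (tmap fst fst (w (rho k))) t.
Proof.
move=> ei ej; rewrite (linear_tens_lift _ leval (prod_bilinl ijk)).
have E c d : eval (free_tree (prod_op c (prod_op d (Leaf i) (Leaf j)) (Leaf k))) =
    P2 (tmap fst fst (w (rho k))) (c ⊗ d).
  rewrite -weight_form_plain_plain.
  exact: (weight_eval_even Bw (plain c) (plain d) ijk ei ej).
rewrite (eq_tens_lift _ E).
have Bp : bilin (fun c d => P2 (tmap fst fst (w (rho k))) (c ⊗ d)).
  by split=> [d|c]; apply: linear_comp (B2.2 _) _; [exact: pure_bilin.1|exact: pure_bilin.2].
by move: t; apply: tens_ext => [||c d]; [exact: tens_lift_linear|exact: B2.2|rewrite tens_lift_pure].
Qed.

Lemma eval_left_odd t : rho i = ordS (ordS (rho k)) -> rho j = ordS (rho k) ->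
  eval (tens_lift (fun c d => free_tree (prod_op c (prod_op d (Leaf i) (Leaf j)) (Leaf k))) t) =
  - P2 (tmap fst snd (w (rho k))) t.
Proof.
move=> ei ej; rewrite (linear_tens_lift _ leval (prod_bilinl ijk)).
have lP : linear (fun t => - P2 (tmap fst snd (w (rho k))) t).
  by move=> x u v; rewrite B2.2 opprD scalerN.
have E c d : eval (free_tree (prod_op c (prod_op d (Leaf i) (Leaf j)) (Leaf k))) =
    - P2 (tmap fst snd (w (rho k))) (c ⊗ d).
  rewrite -weight_form_plain_reversed.
  exact: (weight_eval_odd Bw (plain c) (plain d) ijk ei ej).
rewrite (eq_tens_lift _ E).
have Bp : bilin (fun c d => - P2 (tmap fst snd (w (rho k))) (c ⊗ d)).
  by split=> [d|c]; apply: linear_comp lP _; [exact: pure_bilin.1|exact: pure_bilin.2].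
by move: t; apply: tens_ext => [||c d]; [exact: tens_lift_linear|exact: lP|rewrite tens_lift_pure].
Qed.

Lemma eval_right_even c d : rho i = ordS (rho k) -> rho j = ordS (ordS (rho k)) ->
  eval (free_tree (prod_op c (Leaf k) (prod_op d (Leaf i) (Leaf j)))) =
  - P2 (tmap snd fst (w (rho k))) (c ⊗ d).
Proof.
move=> ei ej; rewrite (free_prod_act _ _ ijk) -weight_form_reversed_plain.
exact: (weight_eval_even Bw (reversed c) (plain d) ijk ei ej).
Qed.

Lemma eval_right_odd c d : rho i = ordS (ordS (rho k)) -> rho j = ordS (rho k) ->
  eval (free_tree (prod_op c (Leaf k) (prod_op d (Leaf i) (Leaf j)))) =
  P2 (tmap snd snd (w (rho k))) (c ⊗ d).
Proof.
move=> ei ej; rewrite (free_prod_act _ _ ijk) -weight_form_reversed_reversed.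
exact: (weight_eval_odd Bw (reversed c) (plain d) ijk ei ej).
Qed.

End Inputs.

Lemma eval_prelie a b : eval (prelie_elt a b) =
  (eval (free_tree (prod_op a (Leaf 0) (prod_op b (Leaf 1) (Leaf 2))))
   - eval (tens_lift (fun c d =>
       free_tree (prod_op c (prod_op d (Leaf 0) (Leaf 1)) (Leaf 2))) (Phi (a ⊗ b))))
  - (eval (free_tree (prod_op b (Leaf 1) (prod_op a (Leaf 0) (Leaf 2))))
   - eval (tens_lift (fun c d =>
       free_tree (prod_op c (prod_op d (Leaf 1) (Leaf 0)) (Leaf 2))) (Phi (b ⊗ a)))).
Proof.
apply: etrans (linearBB leval _ _) _.
by congr (_ - _); exact: (linearBB leval).
Qed.

(** The four terms of the relation give, up to a common sign, the four terms of
    [perm_normal_pairing]. The relation is antisymmetric under exchanging [a] with [b] and the input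
    0 with the input 1, hence the sign and the arguments [b ⊗ a] here, against [a ⊗ b] in the odd
    case. *)
Lemma prelie_eval_even a b : rho 1 = ordS (rho 0) -> rho 2 = ordS (ordS (rho 0)) ->
  eval (prelie_elt a b) = - P2 (perm_normal (transpose Phi) w (ordS (rho 0))) (b ⊗ a).
Proof.
move=> e1 e2; have c012 := three_inputs012; have c102 := three_inputsC c012.
have e0 : rho 0 = ordS (rho 2) by rewrite e2 ordS3.
have e01 : rho 0 = ordS (ordS (rho 1)) by rewrite e1 ordS3.
have e12 : rho 1 = ordS (ordS (rho 2)) by rewrite e2 ordS3.
have e21 : rho 2 = ordS (rho 1) by rewrite e2 e1.
have V1 := eval_right_even (three_inputs_shift c012) a b e1 e2.
have V2 := eval_left_even c012 (Phi (a ⊗ b)) e0 e12.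
have V3 := eval_right_odd (three_inputs_shift c102) b a e01 e21.
have V4 := eval_left_odd c102 (Phi (b ⊗ a)) e12 e0.
rewrite eval_prelie; transitivity (
  - P2 (tmap snd fst (w (rho 0))) (a ⊗ b) - P2 (tmap fst fst (w (rho 2))) (Phi (a ⊗ b))
  - (P2 (tmap snd snd (w (rho 1))) (b ⊗ a) - - P2 (tmap fst snd (w (rho 2))) (Phi (b ⊗ a)))).
  by congr ((_ - _) - (_ - _)).
have sumE (V : zmodType) (x y z t : V) : - x - y - (z - - t) = - (z + x + y + t).
  by rewrite opprK !opprD addrA; congr (_ - t); rewrite addrC addrA.
by rewrite sumE perm_normal_pairing -e1 -e01 -e21.
Qed.

Lemma prelie_eval_odd a b : rho 1 = ordS (ordS (rho 0)) -> rho 2 = ordS (rho 0) ->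
  eval (prelie_elt a b) = P2 (perm_normal (transpose Phi) w (rho 0)) (a ⊗ b).
Proof.
move=> e1 e2; have c012 := three_inputs012; have c102 := three_inputsC c012.
have e0 : rho 0 = ordS (rho 1) by rewrite e1 ordS3.
have e02 : rho 0 = ordS (ordS (rho 2)) by rewrite e2 ordS3.
have e12 : rho 1 = ordS (rho 2) by rewrite e2 e1.
have e21 : rho 2 = ordS (ordS (rho 1)) by rewrite -e0 e2.
have V1 := eval_right_odd (three_inputs_shift c012) a b e1 e2.
have V2 := eval_left_odd c012 (Phi (a ⊗ b)) e02 e12.
have V3 := eval_right_even (three_inputs_shift c102) b a e0 e21.
have V4 := eval_left_even c102 (Phi (b ⊗ a)) e12 e02.
rewrite eval_prelie; transitivity (
  P2 (tmap snd snd (w (rho 0))) (a ⊗ b) - - P2 (tmap fst snd (w (rho 2))) (Phi (a ⊗ b))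
  - (- P2 (tmap snd fst (w (rho 1))) (b ⊗ a) - P2 (tmap fst fst (w (rho 2))) (Phi (b ⊗ a)))).
  by congr ((_ - _) - (_ - _)).
have sumE (V : zmodType) (x y z t : V) : z - - t - (- x - y) = z + x + y + t.
  by rewrite opprK opprD !opprK -addrA [t + _]addrC !addrA.
by rewrite sumE perm_normal_pairing -e1 -e2.
Qed.

End PreLieEval.

Lemma prelie_orthogonal (w : weight2 (free_s2 B)) : (forall k, perm_normal (transpose Phi) w k = 0) ->
  forall u, S3_span (prelie_rel Phi) (weight2_op u) ->
  weight2_pairing [ffun k => tmap to_sgn_dual to_sgn_dual (w k)] u = 0.
Proof.
move=> w0 u Su; rewrite -weight_eval_op.
have leval (rho : 'I_3 -> 'I_3) : linear (weight_eval (weight_form w) rho) :=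
  weight_eval_linear (weight_form_bilin w) rho.
(* All injective assignments of variables are treated together, since a permutation of the inputs is
   absorbed into [rho]. *)
suff: forall rho : 'I_3 -> 'I_3, injective rho ->
    weight_eval (weight_form w) rho (weight2_op u) = 0 by apply.
elim: {u} (weight2_op u) / Su => [_ [a b]||c r s _ IHr _ IHs|f Bf r _ IH] rho rI.
- rewrite -/(prelie_elt a b).
  have [[e2 e0]|[e2 e0]] := three_inputs_cases (three_inputs_shift (three_inputs_inj rI)).
    by rewrite prelie_eval_even // w0 (linear_fun0 (B2.1 _)) oppr0.
  by rewrite prelie_eval_odd // w0 (linear_fun0 (B2.1 _)).
- exact: (linear_fun0 (leval rho)).
- by rewrite leval IHr // IHs // scaler0 addr0.
- rewrite weight_eval_map; last exact: weight_form_bilin.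
  have I : injective (rho \o f) := inj_comp rI (bij_inj Bf).
  exact (IH (rho \o f) I).
Qed.

(** By [prelie_eval_odd], every value of the [k]-th normal component on a pure tensor is a pairing
    with a translated relation. These values vanish, and they determine the component because the
    pairing is nondegenerate. *)
Lemma orthogonal_normal (w : weight2 (free_s2 B)) :
  (forall u, S3_span (prelie_rel Phi) (weight2_op u) ->
   weight2_pairing [ffun k => tmap to_sgn_dual to_sgn_dual (w k)] u = 0) ->
  forall k, perm_normal (transpose Phi) w k = 0.
Proof.
move=> orth k.
(* The odd permutation sending 0, 1, 2 to [k], [k+2], [k+1]. *)
have [f [Bf f0 f1 f2]] := 
  three_inputs_perm (three_inputs_shift (three_inputs_shift (three_inputsC (three_inputs_rot k)))).
have fr : frame P2 (fun ij => @bas K A ij.1 ⊗ bas ij.2) (fun ij => @cobas K A ij.1 ⊗ cobas ij.2).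
  by apply: tframe; try exact: ev_bilin; exact: cobas_frame.
apply: (frame_inj fr); apply: tens_ext; [exact: B2.2|exact: B2.2|move=> a b].
rewrite (linear_fun0 (B2.1 _)).
(* Orthogonality speaks of elements [weight2_op u], so the translated relation is first put in this
   form. *)
have [u eu] := weight2_op_surj (op_map _ Bf (prelie_elt a b)).
have : weight_eval (weight_form w) id (op_map _ Bf (prelie_elt a b)) = 0.
  rewrite eu weight_eval_op; apply: orth; rewrite -eu.
  exact/S3_span_perm/S3_span_gen/Prelie_rel.
rewrite weight_eval_map; last exact: weight_form_bilin.
have e1 : f 1 = ordS (ordS (f 0)) by rewrite f0.
have e2 : f 2 = ordS (f 0) by rewrite f0.
by rewrite -f0 => <-; apply: esym; apply: (prelie_eval_odd w a b e1 e2).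
Qed.

End PreLieOrthogonal.

(** * Correspondence of the two ideals under the identification of the generators *)

Theorem proposition3p2 (K : fieldType) (charK : [pchar K] =i pred0)
    (A : vectType K) (Phi : lCEDS A) :
  operad_iso (quad_operad (koszul_dual (PreLie Phi)))
    (quad_operad (Perm (transpose Phi))).
Proof.
have [lt lo] := (@to_sgn_dual_linear K A, @of_sgn_dual_linear K A).
have [st so] := (@to_sgn_dual_act K A, @of_sgn_dual_act K A).
apply: (quot_operad_iso (free_map_hom lo so) (free_map_hom lt st)).
(* An orthogonal element has zero normal form, hence vanishes modulo the permutative relations. *)
- move=> X _ [_ [v -> orth]]; rewrite (free_map_weight2 lo so); apply/qcls_eq0.
  apply: etrans (perm_normalE _ _) _; rewrite big1 // => k _; rewrite orthogonal_normal.
    exact/linear_fun0/tens_lift_linear/perm_node_bilin/reversed_linear/reversed_linear.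
  move=> u Su; rewrite -[RHS](orth u Su); congr (weight2_pairing _ u).
  apply/ffunP => l; rewrite !ffunE tmap_comp // tmap_id //; exact: of_sgn_dualK.
(* Conversely, a permutative relation has zero normal form, hence is orthogonal to all translates of
   the prelie relations. *)
- move=> X _ [r /perm_rel_weight2[w -> w0]]; rewrite (free_map_weight2 lt st).
  apply/ideal_gen/Quad_ideal_gen;
  exists [ffun k => tmap (@to_sgn_dual K A) (@to_sgn_dual K A) (w k)] => //.
  exact: prelie_orthogonal w0.
- exact: free_map_can of_sgn_dualK.
- exact: free_map_can to_sgn_dualK.
Qed.
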